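(* Let $J\subset\mathbb{R}$ be an interval and let $\mathbf{a}$ be a knot sequence in $J$. Suppose $\Phi^{0}$ and $\Phi^{1}$ are orthogonal bases centered on the common knot sequence $\mathbf{a}$ such that $V^0\subset V^1$, where $V^0=S(\Phi^0)$ and $V^1=S(\Phi^1)$. Then there exists an orthogonal basis $\Psi$ centered on $\mathbf{a}$ such that $W=S(\Psi)$ satisfies $V^1=V^0\oplus W$ (orthogonal direct sum in $L^2(J)$; that is, $W=V^1\ominus V^0$ is the orthogonal complement of $V^0$ in $V^1$).
   Context: A knot sequence in an interval $J\subset\mathbb{R}$ is a set $\mathbf{a}\subset J$ with at least three elements, having no cluster point in $J$, and with $\inf\mathbf{a}=\inf J$ and $\sup\mathbf{a}=\sup J$. For $a\in\mathbf{a}$ let $a_+:=\inf\{b\in\mathbf{a}: a<b\}$ (successor) and $a_-:=\sup\{b\in\mathbf{a}: b<a\}$ (predecessor), with $a_+=\infty$ if $a=\sup J$ and $a_-=-\infty$ if $a=\inf J$. For $G\subset L^2(J)$ and an interval $I$, let $G_I:=\{g\in G:\operatorname{supp} g\subset I\}$. A collection $\Phi\subset L^2(J)$ is locally finite if on any compact interval $K\subset J$ all but finitely many $\phi\in\Phi$ vanish on $K$. For such $\Phi$ and $a\in\mathbf{a}$ define $\breve\Phi_a:=\Phi_{[a,a_+]}$, $\Phi_a:=\Phi_{[a_-,a_+]}\setminus\breve\Phi_{a_-}$, $\bar\Phi_a:=\Phi_a\setminus\breve\Phi_a$, with $\breve\Phi_{-\infty}:=\emptyset$ and $\bar\Phi_{\infty}:=\emptyset$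 (so $\Phi_a=\emptyset$ if $a=\sup J\in J$, and $\bar\Phi_a=\emptyset$ if $a=\inf J\in J$). $\Phi\subset L^2(J)$ is a basis centered on the knot sequence $\mathbf{a}$ if: (a) $\Phi$ is locally finite; (b) $\Phi=\bigcup_{a\in\mathbf{a}}\Phi_a$; (c) for every $a\in\mathbf{a}$ the restrictions to $[a,a_+]$ of the functions in $\Phi_a\cup\bar\Phi_{a_+}$ form a linearly independent set. It is an orthogonal basis centered on $\mathbf{a}$ if in addition its elements are mutually orthogonal in $L^2(J)$. Define $S(\Phi):=\operatorname{clos}_{L^2(J)}\operatorname{span}(\Phi)$. *)

(* Defs.v *)
From HB Require Import structures.
From mathcomp Require Import all_boot all_order all_algebra.
From mathcomp Require Import all_classical all_reals all_analysis.

Set Implicit Arguments.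
Unset Strict Implicit.
Unset Printing Implicit Defensive.
Import Order.TTheory GRing.Theory Num.Theory.
Import numFieldNormedType.Exports.

Local Open Scope classical_set_scope.
Local Open Scope card_scope.
Local Open Scope ring_scope.

Definition lebesgue_on {R : realType} (J : interval R) :
    {measure set (measurableTypeR R) -> \bar R} :=
  mrestr (@lebesgue_measure R) (measurable_itv J).

(* Real-valued L^2(J): classes of functions on R modulo equality a.e. on J. *)
Definition L2 {R : realType} (J : interval R) : Type :=
  LspaceType2 (lebesgue_on J).

(* Some representative, with codomain R rather than measurableTypeR R. *)
Definition L2_repr {R : realType} {J : interval R} (f : L2 J) : R -> R :=
  (f : LspaceType2 (lebesgue_on J)).
Coercion L2_repr : L2 >-> Funclass.

Section knots.
Context {R : realType}.
Implicit Types (J : interval R) (a : set R).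

Definition knot_sequence J a : Prop :=
  [/\ a `<=` [set` J],
      `I_3 #<= a,
      [set` J] `&` limit_point a = set0,
      ereal_inf (EFin @` a) = ereal_inf (EFin @` [set` J]) &
      ereal_sup (EFin @` a) = ereal_sup (EFin @` [set` J])].

(* +oo when x is the largest knot, since ereal_inf set0 = +oo; dually below. *)
Definition knot_succ a (x : R) : \bar R :=
  ereal_inf (EFin @` [set b | a b /\ x < b]).

Definition knot_pred a (x : R) : \bar R :=
  ereal_sup (EFin @` [set b | a b /\ b < x]).

(* Closed interval of R with possibly infinite endpoints. *)
Definition eitv (x y : \bar R) : set R := [set t | (x <= t%:E <= y)%E].

End knots.

Section L2_theory.
Context {R : realType} {J : interval R}.
Local Notation mu := (lebesgue_on J).
Implicit Types (f g phi : L2 J) (Phi V W : set (L2 J)) (I K : set R).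

Definition L2_inner f g : R := \int[mu]_x (f x * g x).

Definition L2_dist f g : \bar R := 'N[mu]_2%:E[EFin \o (f \- g)%R]%E.

Definition vanishes_on K f : Prop := ae_eq mu K f (cst 0).

(* Essential support, closed in R. *)
Definition supp f : set R := [set t | forall U, nbhs t U -> ~ vanishes_on U f].

Definition supported_in Phi I : set (L2 J) :=
  [set g : L2 J | Phi g /\ supp g `<=` I].

Definition locally_finite Phi : Prop :=
  forall x y : R, `[x, y] `<=` [set` J] ->
    finite_set [set phi : L2 J | Phi phi /\ ~ vanishes_on `[x, y] phi].

Definition lincomb n (c : 'I_n -> R) (phi : 'I_n -> L2 J) : R -> R :=
  fun x => \sum_(i < n) c i * phi i x.

(* Independence of the family of restrictions: distinct elements of Phi count
   as distinct members even if they agree on I. *)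
Definition restr_lin_indep I Phi : Prop :=
  forall n (phi : 'I_n -> L2 J) (c : 'I_n -> R),
    injective phi -> (forall i, Phi (phi i)) ->
    ae_eq mu I (lincomb c phi) (cst 0) -> forall i, c i = 0.

Definition L2_span Phi : set (L2 J) :=
  [set f : L2 J | exists n (phi : 'I_n -> L2 J) (c : 'I_n -> R),
    (forall i, Phi (phi i)) /\ ae_eq mu setT f (lincomb c phi)].

Definition L2_closure V : set (L2 J) :=
  [set f : L2 J | forall e : R, 0 < e ->
    exists2 g, V g & (L2_dist f g < e%:E)%E].

Definition clspan Phi : set (L2 J) := L2_closure (L2_span Phi).

Definition orthogonal_sets V W : Prop :=
  forall f g, V f -> W g -> L2_inner f g = 0.

Definition sum_sets V W : set (L2 J) :=
  [set f : L2 J | exists v w, [/\ V v, W w & ae_eq mu setT f (v \+ w)]].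

Definition is_orthogonal_sum V1 V W : Prop :=
  orthogonal_sets V W /\ V1 = sum_sets V W.

Definition orthocomplement_in V1 V : set (L2 J) :=
  [set f : L2 J | V1 f /\ forall g, V g -> L2_inner f g = 0].

Section centered.
Variables (a : set R) (Phi : set (L2 J)).

(* Subscripts range over the knots together with -oo and +oo. *)
Definition breve (x : \bar R) : set (L2 J) :=
  if x is r%:E then supported_in Phi (eitv x (knot_succ a r)) else set0.

Definition at_knot (x : R) : set (L2 J) :=
  supported_in Phi (eitv (knot_pred a x) (knot_succ a x))
    `\` breve (knot_pred a x).

Definition bar (x : \bar R) : set (L2 J) :=
  if x is r%:E then at_knot r `\` breve x else set0.

Definition centered_basis : Prop :=
  [/\ locally_finite Phi,
      Phi = \bigcup_(x in a) at_knot x &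
      forall x, a x ->
        restr_lin_indep (eitv x%:E (knot_succ a x))
          (at_knot x `|` bar (knot_succ a x))].

Definition orthogonal_centered_basis : Prop :=
  centered_basis /\
  forall f g, Phi f -> Phi g -> f <> g -> L2_inner f g = 0.

End centered.
End L2_theory.

(* Main.v *)
Require Import Defs.
From HB Require Import structures.
From mathcomp Require Import all_boot all_order all_algebra.
From mathcomp Require Import all_classical all_reals all_analysis.
From mathcomp Require Import measurable_realfun lra.

(** Write A_i x for the elements of Phi_i supported in [x, x+] and B_i x for those
    supported in [x-, x+] but in neither half. Since V0 is contained in V1, A_0 x lies
    in the span of A_1 x and B_0 x in that of A_1 x-, B_1 x and A_1 x. Let R x and L x be
    the projections of B_0 x to the spans of A_1 x- and A_1 x. Orthogonality of B_0 x
    and B_0 x+ forces L x and R x+, which both live on [x, x+], to be orthogonal. Hence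
    V1 is the orthogonal sum of the spaces
      span (A_1 x) minus (A_0 x + L x + R x+)   (supported in [x, x+]),
      T x = R x + B_1 x + L x                   (supported in [x-, x+])
    and of the spans of the A_0 x, while T x contains B_0 x. Orthogonal bases AW x of the
    first spaces and BW x of the complements of B_0 x in T x form the basis of W.
    Local independence is inherited from Phi_1 once no nonzero element of the span of
    BW x is supported in a single interval, which holds since such an element would be
    in the span of some AW y. *)

Set Implicit Arguments.
Unset Strict Implicit.
Unset Printing Implicit Defensive.
Import Order.TTheory GRing.Theory Num.Theory.
Import numFieldNormedType.Exports.

Local Open Scope classical_set_scope.
Local Open Scope ring_scope.

(** * Inner product spaces *)

(** A basis is described by the supports of single functions, whereas [V0] and [V1] are closures of
    infinite spans. Local independence bridges the gap: it forces an element of [V1] supported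
    between two knots to be a finite combination of basis functions supported there. The inclusion
    of [V0] in [V1] thus becomes a family of finite-dimensional inclusions, and the choice of [AW]
    and [BW] is linear algebra over an abstract inner product, indexed by a set with successor and
    predecessor maps. The obstacle is that coarse long functions at neighbouring knots have
    components in the same space span (A_1 x). A complement formed at one knot therefore has to
    respect its neighbours, or the pieces would not be orthogonal across knots. That [V0] and [W]
    exhaust [V1] requires an orthogonal projection onto the infinite-dimensional [V0]; it is built
    from local finiteness and Fatou's lemma. *)

Record inner_product (R : realFieldType) (V : lmodType R) (ip : V -> V -> R) :
    Prop := InnerProduct {
  ipC : forall u v, ip u v = ip v u;
  ip_lin : forall c u v w, ip (c *: u + v) w = c * ip u w + ip v w;
  ip_ge0 : forall u, 0 <= ip u u;
  ip_eq0 : forall u, ip u u = 0 -> u = 0 }.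

Section span.
Context {R : realFieldType} {V : lmodType R}.
Implicit Types (S T U : set V) (u v w : V).

Definition linspan S : set V := [set v | exists n (phi : 'I_n -> V) (c : 'I_n -> R),
  (forall i, S (phi i)) /\ v = \sum_(i < n) c i *: phi i].

Definition submodule U := U 0 /\ forall c u v, U u -> U v -> U (c *: u + v).

Lemma submodule_sum U n (phi : 'I_n -> V) (c : 'I_n -> R) : submodule U ->
  (forall i, U (phi i)) -> U (\sum_(i < n) c i *: phi i).
Proof.
move=> [U0 UP] Uphi; elim/big_ind : _ => // [u v Uu Uv|i _].
  by rewrite -[u]scale1r; exact: UP.
by rewrite -[X in U X]addr0; exact: UP.
Qed.

Lemma submoduleD U u v : submodule U -> U u -> U v -> U (u + v).
Proof. by move=> [U0 UP] Uu Uv; rewrite -[u]scale1r; exact: UP. Qed.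

Lemma submoduleZ U c u : submodule U -> U u -> U (c *: u).
Proof. by move=> [U0 UP] Uu; rewrite -[X in U X]addr0; exact: UP. Qed.

Lemma submoduleB U u v : submodule U -> U u -> U v -> U (u - v).
Proof. by move=> [U0 UP] Uu Uv; rewrite addrC -scaleN1r; exact: UP. Qed.

Lemma linspan_sub S U : submodule U -> S `<=` U -> linspan S `<=` U.
Proof. by move=> sU SU v [n [phi [c [Sphi ->]]]]; apply: submodule_sum => // i; exact: SU. Qed.

Lemma sub_linspan S : S `<=` linspan S.
Proof.
move=> v Sv; exists 1, (fun=> v), (fun=> 1).
by split => //; rewrite big_ord1 scale1r.
Qed.

Lemma linspan_submodule S : submodule (linspan S).
Proof.
split.
  by exists 0, (fun=> 0), (fun=> 0); split; [case|rewrite big_ord0].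
move=> k u v [n [f [c [Sf ->]]]] [m [g [d [Sg ->]]]].
exists (n + m), (fun i => match fintype.split i with inl j => f j | inr j => g j end),
  (fun i => match fintype.split i with inl j => k * c j | inr j => d j end).
split; first by move=> i; case: (fintype.split i).
rewrite big_split_ord /= scaler_sumr; congr (_ + _); apply: eq_bigr => i _.
  by have := unsplitK (inl i : 'I_n + 'I_m) => /= ->; rewrite scalerA.
by have := unsplitK (inr i : 'I_n + 'I_m) => /= ->.
Qed.

Lemma linspan0 S : linspan S 0. Proof. exact: (linspan_submodule S).1. Qed.

Lemma linspanD S u v : linspan S u -> linspan S v -> linspan S (u + v).
Proof. exact: (submoduleD (linspan_submodule S)). Qed.

Lemma linspanB S u v : linspan S u -> linspan S v -> linspan S (u - v).
Proof. exact: (submoduleB (linspan_submodule S)). Qed.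

Lemma linspanZ S c u : linspan S u -> linspan S (c *: u).
Proof. exact: (submoduleZ c (linspan_submodule S)). Qed.

Lemma linspan_le S T : S `<=` linspan T -> linspan S `<=` linspan T.
Proof. exact: (linspan_sub (linspan_submodule T)). Qed.

Lemma linspanS S T : S `<=` T -> linspan S `<=` linspan T.
Proof. by move=> ST; apply: linspan_le => u /ST; exact: sub_linspan. Qed.

Lemma linspan_set0 u : linspan set0 u -> u = 0.
Proof.
apply: (@linspan_sub set0 [set 0]) => //.
by split => // c _ _ /= -> ->; rewrite scaler0 addr0.
Qed.

Lemma linspanU S T w : linspan (S `|` T) w ->
  exists u v, [/\ linspan S u, linspan T v & w = u + v].
Proof.
apply: (@linspan_sub (S `|` T)
  [set w | exists u v, [/\ linspan S u, linspan T v & w = u + v]]).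
  split; first by exists 0, 0; rewrite addr0; split => //; exact: linspan0.
  move=> c _ _ [u [v [Su Tv ->]]] [u' [v' [Su' Tv' ->]]].
  exists (c *: u + u'), (c *: v + v'); split.
  - by apply: linspanD => //; exact: linspanZ.
  - by apply: linspanD => //; exact: linspanZ.
  - by rewrite scalerDr addrACA.
move=> v [Sv|Tv].
  by exists v, 0; rewrite addr0; split => //; [exact: sub_linspan|exact: linspan0].
by exists 0, v; rewrite add0r; split => //; [exact: linspan0|exact: sub_linspan].
Qed.

Lemma linspan_seq (t : seq V) w : uniq t -> linspan [set` t] w ->
  exists c : V -> R, w = \sum_(v <- t) c v *: v.
Proof.
move=> ut; apply: (@linspan_sub _ [set w | exists c : V -> R, w = \sum_(v <- t) c v *: v]).
  split; first by exists (fun=> 0); rewrite big1// => i _; rewrite scale0r.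
  move=> k _ _ [c ->] [d ->]; exists (fun v => k * c v + d v).
  rewrite scaler_sumr -big_split /=; apply: eq_bigr => v _.
  by rewrite scalerDl scalerA.
move=> v /= vt; exists (fun u => (u == v)%:R).
rewrite (bigD1_seq v)//= eqxx scale1r big1 ?addr0// => u /negPf ->.
by rewrite scale0r.
Qed.

End span.

(** * Orthogonality, closures and projections onto finite spans *)

Section inner.
Context {R : realFieldType} {V : lmodType R} {ip : V -> V -> R}.
Hypothesis ipP : inner_product ip.
Implicit Types (S T U : set V) (u v w : V).

Lemma ip0l u : ip 0 u = 0.
Proof. by have := ip_lin ipP 1 0 0 u; rewrite scale1r addr0; lra. Qed.

Lemma ipDl u v w : ip (u + v) w = ip u w + ip v w.
Proof. by rewrite -[u]scale1r (ip_lin ipP) mul1r scale1r. Qed.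

Lemma ipZl c u w : ip (c *: u) w = c * ip u w.
Proof. by rewrite -[c *: u]addr0 (ip_lin ipP) ip0l addr0. Qed.

Lemma ipNl u w : ip (- u) w = - ip u w.
Proof. by rewrite -scaleN1r ipZl mulN1r. Qed.

Lemma ipBl u v w : ip (u - v) w = ip u w - ip v w.
Proof. by rewrite ipDl ipNl. Qed.

Lemma ip0r u : ip u 0 = 0. Proof. by rewrite (ipC ipP) ip0l. Qed.

Lemma ipDr w u v : ip w (u + v) = ip w u + ip w v.
Proof. by rewrite !(ipC ipP w) ipDl. Qed.

Lemma ipZr c w u : ip w (c *: u) = c * ip w u.
Proof. by rewrite !(ipC ipP w) ipZl. Qed.

Lemma ipNr w u : ip w (- u) = - ip w u.
Proof. by rewrite !(ipC ipP w) ipNl. Qed.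

Lemma ipBr w u v : ip w (u - v) = ip w u - ip w v.
Proof. by rewrite !(ipC ipP w) ipBl. Qed.

Lemma pythagoras u v : ip u v = 0 -> ip (u + v) (u + v) = ip u u + ip v v.
Proof. by move=> uv; rewrite ipDl !ipDr (ipC ipP v u) uv addr0 add0r. Qed.

Lemma cauchy_schwarz u v : ip u v ^+ 2 <= ip u u * ip v v.
Proof.
have [/(ip_eq0 ipP) ->|v0] := eqVneq (ip v v) 0.
  by rewrite !ip0r mulr0 expr0n.
have vp : 0 < ip v v by rewrite lt0r v0 (ip_ge0 ipP).
(* The squared norm of this vector is [ip v v * (ip u u * ip v v - ip u v ^+ 2)]. *)
have := ip_ge0 ipP (ip v v *: u - ip u v *: v).
rewrite ipBl !ipBr !ipZl !ipZr (ipC ipP v u) => H.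
have : 0 <= ip v v * (ip u u * ip v v - ip u v ^+ 2) by lra.
by rewrite pmulr_rge0// subr_ge0.
Qed.

Definition orth S T := forall u v, S u -> T v -> ip u v = 0.

Lemma orthC S T : orth S T -> orth T S.
Proof. by move=> ST u v Tu Sv; rewrite (ipC ipP); exact: ST. Qed.

Lemma orth_submodule T : submodule [set u | forall v, T v -> ip u v = 0].
Proof.
split; first by move=> v _; rewrite ip0l.
by move=> c u v Hu Hv w Tw; rewrite ipDl ipZl Hu// Hv// mulr0 addr0.
Qed.

Lemma orth_spanl S T : orth S T -> orth (linspan S) T.
Proof.
move=> ST u v Su; move: u Su v; apply: linspan_sub; first exact: orth_submodule.
by move=> u Su v; exact: ST.
Qed.

Lemma orth_span S T : orth S T -> orth (linspan S) (linspan T).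
Proof. by move/orth_spanl/orthC/orth_spanl/orthC. Qed.

Lemma orthSS S T S' T' : S' `<=` linspan S -> T' `<=` linspan T -> orth S T -> orth S' T'.
Proof. by move=> SS TT /orth_span ST u v /SS Su /TT; exact: ST. Qed.

Lemma orthUr S T U : orth S T -> orth S U -> orth S (T `|` U).
Proof. by move=> ST SU u v Su [|]; [exact: ST|exact: SU]. Qed.

Lemma orthUl S T U : orth T S -> orth U S -> orth (T `|` U) S.
Proof. by move=> ST SU u v [|]; [exact: ST|exact: SU]. Qed.

Lemma orth_self u S : linspan S u -> (forall v, S v -> ip u v = 0) -> u = 0.
Proof.
move=> Su uS; apply: (ip_eq0 ipP).
by apply: (@orth_span [set u] S) => //; [move=> _ v -> ; exact: uS|exact: sub_linspan].
Qed.

Lemma orth3_eq0 u v w : ip u v = 0 -> ip u w = 0 -> ip v w = 0 ->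
  u + v + w = 0 -> [/\ u = 0, v = 0 & w = 0].
Proof.
move=> uv uw vw S0; have E z : ip (u + v + w) z = 0 by rewrite S0 ip0l.
split; apply: (ip_eq0 ipP).
- by have := E u; rewrite !ipDl (ipC ipP v) (ipC ipP w) uv uw !addr0.
- by have := E v; rewrite !ipDl (ipC ipP w) uv vw add0r addr0.
- by have := E w; rewrite !ipDl uw vw !add0r.
Qed.

(** Distances enter squared because a [realFieldType] need not have square roots; [clspanE] makes
    the link with [L2_closure]. *)
Definition clos U : set V :=
  [set f | forall e, 0 < e -> exists2 g, U g & ip (f - g) (f - g) < e].

Lemma sub_clos U : U `<=` clos U.
Proof. by move=> u Uu e e0; exists u => //; rewrite subrr ip0l. Qed.

(** By the parallelogram law. It plays the role of the triangle inequality for squared distances and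
    is the source of the factors 4 below. *)
Lemma ip_sqrD_le u v : ip (u + v) (u + v) <= 2 * (ip u u + ip v v).
Proof.
have := ip_ge0 ipP (u - v).
by rewrite ipBl !ipBr ipDl !ipDr (ipC ipP v u); lra.
Qed.

Lemma clos_submodule U : submodule U -> submodule (clos U).
Proof.
move=> [U0 UP]; split; first exact: sub_clos.
move=> c u v cu cv e e0.
(* Adding 1 to [c ^+ 2] keeps the divisor positive when [c = 0]. *)
have k0 : 0 < 4 * (c ^+ 2 + 1) by have := sqr_ge0 c; lra.
have [|u' Uu' uu'] := cu (e / (4 * (c ^+ 2 + 1))); first by rewrite divr_gt0.
have [|v' Uv' vv'] := cv (e / 4); first by rewrite divr_gt0.
exists (c *: u' + v'); first exact: UP.
rewrite (_ : c *: u + v - _ = c *: (u - u') + (v - v')); last first.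
  by rewrite scalerBr opprD addrACA.
apply: le_lt_trans (ip_sqrD_le _ _) _.
rewrite ipZl ipZr; rewrite ltr_pdivlMr// in uu'.
have := ip_ge0 ipP (u - u').
set x := ip _ _ in uu' *; set y := ip _ _ in vv' * => x0.
have : c * (c * x) <= (c ^+ 2 + 1) * x by lra.
by lra.
Qed.

Lemma orth_clos S T : orth S T -> orth (clos S) (clos T).
Proof.
suff H : forall S T, orth S T -> orth (clos S) T by move=> /H/orthC/H/orthC.
move=> {}S {}T ST f t cf Tt; apply/eqP/negPn/negP => ft0.
have t0 : ip t t != 0.
  by apply: contra_neq ft0 => /(ip_eq0 ipP) ->; rewrite ip0r.
have tp : 0 < ip t t by rewrite lt0r t0 (ip_ge0 ipP).
(* With this radius Cauchy-Schwarz gives [ip (f - g) t ^+ 2 < ip f t ^+ 2], while [g] is orthogonal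
   to [t]. *)
have [|g Sg] := cf (ip f t ^+ 2 / ip t t); first by rewrite divr_gt0// exprn_even_gt0.
rewrite ltr_pdivlMr// => /(le_lt_trans (cauchy_schwarz _ _)).
by rewrite ipBl (ST _ _ Sg Tt) subr0 ltxx.
Qed.

Lemma clos_orth_eq0 S f : clos (linspan S) f ->
  (forall v, S v -> ip f v = 0) -> f = 0.
Proof.
move=> cf fS; apply: (ip_eq0 ipP).
apply: (@orth_clos (linspan [set f]) (linspan S)) => //.
  by apply: orth_span => _ v ->; exact: fS.
exact/sub_clos/sub_linspan.
Qed.

Lemma clos_closS S T : S `<=` clos (linspan T) ->
  clos (linspan S) `<=` clos (linspan T).
Proof.
move=> ST.
have {}ST : linspan S `<=` clos (linspan T).
  by apply: linspan_sub => //; exact/clos_submodule/linspan_submodule.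
move=> f cf e e0; have [|g /ST cg fg] := cf (e / 4); first by rewrite divr_gt0.
have [|h Th gh] := cg (e / 4); first by rewrite divr_gt0.
exists h => //; rewrite -(subrKA g).
by apply: le_lt_trans (ip_sqrD_le _ _) _; lra.
Qed.

(** Gram-Schmidt, one vector at a time: the projection onto the tail is corrected along [z], the
    part of the head orthogonal to the tail. If [z = 0] the correction is zero and the formula still
    holds. *)
Lemma finite_proj_ex S : finite_set S ->
  forall v, exists p, linspan S p /\ forall u, S u -> ip (v - p) u = 0.
Proof.
move/finite_seqP => [s ->]; elim: s => [|x s IH] v.
  by exists 0; split; [exact: linspan0|].
have ss : linspan [set` s] `<=` linspan [set` x :: s].
  by apply: linspanS => u /= us; rewrite inE us orbT.
have [y [sy xy]] := IH x; have [p [sp vp]] := IH v.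
pose z := x - y.
have sz : linspan [set` x :: s] z.
  apply: linspanB; last exact: ss.
  by apply: sub_linspan; rewrite /= mem_head.
exists (p + (ip v z / ip z z) *: z); split.
  by apply: linspanD; [exact: ss|exact: linspanZ].
have zs u : linspan [set` s] u -> ip z u = 0.
  by move=> su; apply: (@orth_span [set z] [set` s]) => //;
    [move=> _ w -> ; exact: xy|exact: sub_linspan].
have xE : x = z + y by rewrite subrK.
clearbody z.
have vps u : linspan [set` s] u -> ip (v - p) u = 0.
  by move=> su; apply: (@orth_span [set v - p] [set` s]) => //;
    [move=> _ w -> ; exact: vp|exact: sub_linspan].
have H u : linspan [set` s] u -> ip (v - (p + (ip v z / ip z z) *: z)) u = 0.
  by move=> su; rewrite opprD addrA ipBl (vps u)// ipZl (zs u)// mulr0 subr0.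
have Hz : ip (v - (p + (ip v z / ip z z) *: z)) z = 0.
  rewrite opprD addrA !ipBl ipZl (ipC ipP p) (zs p)// subr0.
  have [z0|z0] := eqVneq (ip z z) 0; last by rewrite divfK// subrr.
  by rewrite (ip_eq0 ipP z0) !ip0r mulr0 subr0.
move=> u /=; rewrite inE => /predU1P[->|us]; last exact/H/sub_linspan.
by rewrite xE ipDr Hz H// addr0.
Qed.

(** Picked by choice; [proj_uniq] pins it down when [S] is finite. *)
Definition proj S v := xget 0 [set p | linspan S p /\ forall u, S u -> ip (v - p) u = 0].

Section proj.
Variables (S : set V) (finS : finite_set S).

Let projP v : linspan S (proj S v) /\ forall u, S u -> ip (v - proj S v) u = 0.
Proof. exact: (xgetPex 0 (finite_proj_ex finS v)). Qed.

Lemma proj_span v : linspan S (proj S v). Proof. exact: (projP v).1. Qed.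

Lemma proj_orth v u : linspan S u -> ip (v - proj S v) u = 0.
Proof.
move=> Su; apply: (@orth_span [set v - proj S v] S) => //; last exact: sub_linspan.
by move=> _ w ->; exact: (projP v).2.
Qed.

Lemma ip_proj v u : linspan S u -> ip (proj S v) u = ip v u.
Proof. by move=> /(proj_orth v); rewrite ipBl => /eqP; rewrite subr_eq0 => /eqP. Qed.

Lemma proj_uniq v p : linspan S p -> (forall u, S u -> ip (v - p) u = 0) -> p = proj S v.
Proof.
move=> Sp vp; apply/eqP; rewrite -subr_eq0; apply/eqP; apply: (@orth_self _ S).
  by apply: linspanB => //; exact: proj_span.
move=> u Su; rewrite -(subrKA v) -opprB ipDl ipNl vp// oppr0 add0r proj_orth//.
  exact: sub_linspan.
Qed.

Lemma bessel v : ip (proj S v) (proj S v) <= ip v v.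
Proof.
have h : ip (v - proj S v) (proj S v) = 0 by apply: proj_orth; exact: proj_span.
by have := pythagoras h; rewrite subrK => ->; rewrite lerDr (ip_ge0 ipP).
Qed.

End proj.

(** Excluding [0] makes such a system linearly independent. *)
Definition orthsys S := [/\ ~ S 0 & forall u v, S u -> S v -> u <> v -> ip u v = 0].

(** Gram-Schmidt on the elements of [U], started from [M]: each new vector is reduced modulo the
    span of [M] and of the vectors found so far, and kept if nonzero. The induction works in the
    span of [M] joined to [U], since [M] may leave the span of a tail of the list. *)
Lemma complement_basis M U : finite_set M -> finite_set U -> M `<=` linspan U ->
  exists C, [/\ finite_set C, orthsys C, C `<=` linspan U, orth C M &
    U `<=` linspan (M `|` C)].
Proof.
move=> finM finU MU.
suff : exists C, [/\ finite_set C, orthsys C, C `<=` linspan (M `|` U), orth C M &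
    U `<=` linspan (M `|` C)].
  move=> [C [? ? CU ? ?]]; exists C; split => //.
  by apply: (subset_trans CU); apply: linspan_le => u [/MU|/sub_linspan].
move/finite_seqP : finU => [s ->] {U MU}; elim: s => [|x s [C [finC [C0 oC] CU CM UC]]].
  by exists set0; split => //; split.
have finMC : finite_set (M `|` C) by rewrite finite_setU.
pose z := x - proj (M `|` C) x.
have zMC u : linspan (M `|` C) u -> ip z u = 0 by exact: proj_orth.
have MsMxs : linspan (M `|` [set` s]) `<=` linspan (M `|` [set` x :: s]).
  by apply: linspanS; apply: setUS => u /= us; rewrite inE us orbT.
have [z0|/eqP z0] := eqVneq z 0.
  exists C; split => //; first by move=> u /CU/MsMxs.
  move=> u /=; rewrite inE => /predU1P[->|us]; last exact: UC.
  by move/eqP: z0; rewrite subr_eq0 => /eqP ->; exact: proj_span.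
have MCz : linspan (M `|` C) `<=` linspan (M `|` (C `|` [set z])).
  by apply: linspanS; rewrite setUA; exact: subsetUl.
exists (C `|` [set z]); split.
- by rewrite finite_setU; split.
- split; first by move=> [//|/esym].
  move=> u v [Cu|->] [Cv|->] // uv; first exact: oC.
  + by rewrite (ipC ipP) zMC//; apply: sub_linspan; right.
  + by rewrite zMC//; apply: sub_linspan; right.
- move=> u [/CU/MsMxs//|->]; apply: linspanB.
    by apply: sub_linspan; right; rewrite /= mem_head.
  apply: MsMxs; have := proj_span finMC x; apply: linspan_le => v [Mv|/CU//].
  by apply: sub_linspan; left.
- by apply: orthUl => // _ u -> Mu; rewrite zMC//; apply: sub_linspan; left.
- move=> u /=; rewrite inE => /predU1P[->|us]; last exact/MCz/UC.
  rewrite -(subrK (proj (M `|` C) x) x); apply: linspanD.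
    by apply: sub_linspan; right; right.
  by apply: MCz; exact: proj_span.
Qed.

(** The error [f - proj F f] lies in the closed span of [S] and is orthogonal to all of [S], hence
    is zero. This is how closed spans are reduced to finite ones. *)
Lemma clos_finite S F f : finite_set F -> F `<=` S ->
  (forall u v, S u -> S v -> u <> v -> ip u v = 0) ->
  clos (linspan S) f -> (forall v, S v -> ~ F v -> ip f v = 0) -> linspan F f.
Proof.
move=> finF FS oS cf fF.
suff -> : f = proj F f by exact: proj_span.
apply/eqP; rewrite -subr_eq0; apply/eqP/(@clos_orth_eq0 S).
  apply: (submoduleB (clos_submodule (linspan_submodule S))) => //.
  exact/sub_clos/(linspanS FS)/proj_span.
move=> v Sv; have [Fv|nFv] := pselect (F v).
  by apply: proj_orth => //; exact: sub_linspan.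
rewrite ipBl fF// sub0r; apply/eqP; rewrite oppr_eq0; apply/eqP.
apply: (@orth_span F [set v]) => //; [|exact: proj_span|exact: sub_linspan].
by move=> u _ Fu ->; apply: oS => //; [exact: FS|move=> uv; apply: nFv; rewrite -uv].
Qed.

(** If [u + v] approximates [f], with [u] in the span of [S], then [f - v] is orthogonal to [u], so
    dropping [u] does not increase the distance. *)
Lemma clos_orthU S T f : orth T S -> clos (linspan (S `|` T)) f ->
  (forall v, S v -> ip f v = 0) -> clos (linspan T) f.
Proof.
move=> TS cf fS e /cf[_ /linspanU[u [v [Su Tv ->]]] fuv].
exists v => //; apply: le_lt_trans fuv.
have fvu : ip (f - v) u = 0.
  apply: (@orth_span [set f - v] S) => //; last exact: sub_linspan.
  move=> _ w -> Sw; rewrite ipBl fS// sub0r; apply/eqP; rewrite oppr_eq0; apply/eqP.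
  by apply: (orth_spanl TS).
rewrite (addrC u) opprD addrA (@pythagoras (f - v) (- u)); last by rewrite ipNr fvu oppr0.
by rewrite lerDl (ip_ge0 ipP).
Qed.

End inner.

Arguments orth {R V} ip S T.
Arguments clos {R V} ip U _.
Arguments proj {R V} ip S v.
Arguments orthsys {R V} ip S.

(** * The complement of a coarse basis in a fine one *)

(* [A0], [B0] and [A1], [B1] are the short and long basis vectors of the coarse and of
   the fine space, [s] and [p] the successor and predecessor of a knot, and [N x] the
   space of the vectors vanishing on the interval from [x] to [s x]. *)
Record two_scale_complement (R : realFieldType) (V : lmodType R) (ip : V -> V -> R)
    (I : Type) (K : set I) (s p : I -> I) (A0 B0 A1 B1 N AW BW : I -> set V) : Prop := {
  tsAW_finite : forall x, finite_set (AW x);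
  tsBW_finite : forall x, finite_set (BW x);
  tsAW_orthsys : forall x, orthsys ip (AW x);
  tsBW_orthsys : forall x, orthsys ip (BW x);
  tsAW_sub : forall x, AW x `<=` linspan (A1 x);
  tsBW_sub : forall x, BW x `<=` linspan (A1 (p x) `|` B1 x `|` A1 x);
  tsBW_long : forall x u, BW x u -> (B0 x `|` B1 x) !=set0;
  tsAW_orth : forall x y, x <> y -> orth ip (AW x) (AW y);
  tsBW_orth : forall x y, x <> y -> orth ip (BW x) (BW y);
  tsAW_BW : forall x y, orth ip (AW x) (BW y);
  tsA0_AW : forall x y, orth ip (A0 x) (AW y);
  tsA0_BW : forall x y, orth ip (A0 x) (BW y);
  tsB0_AW : forall x y, orth ip (B0 x) (AW y);
  tsB0_BW : forall x y, orth ip (B0 x) (BW y);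
  tsAW_max : forall x w, K x -> linspan (A1 x) w -> orth ip [set w] (A0 x) ->
    orth ip [set w] (B0 x) -> orth ip [set w] (B0 (s x)) -> linspan (AW x) w;
  ts_gen : forall S, (forall x, A0 x `<=` S) -> (forall x, B0 x `<=` S) ->
    (forall x, AW x `<=` S) -> (forall x, BW x `<=` S) ->
    forall x, A1 x `|` B1 x `<=` linspan S;
  ts_indep : forall x w, K x -> linspan (AW x `|` BW x `|` BW (s x)) w -> N x w -> w = 0 }.

Section two_scale.
Context {R : realFieldType} {V : lmodType R} {ip : V -> V -> R}.
Hypothesis ipP : inner_product ip.
Local Notation orth := (@orth R V ip).
Local Notation proj := (@proj R V ip).
Context {I : Type} (K : set I) (s p : I -> I) (A0 B0 A1 B1 N : I -> set V).
Hypothesis spK : forall x, K x -> K (p x) -> s (p x) = x.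
Hypothesis psK : forall x, K x -> K (s x) -> p (s x) = x.
Hypothesis p_neq : forall x, K x -> p x <> x.
Hypothesis s_neq_p : forall x, K x -> s x <> p x.
Hypothesis s_neq : forall x, K x -> s x <> x.
Hypothesis A1K : forall x u, A1 x u -> K x.
Hypothesis B0K : forall x u, B0 x u -> K x.
Hypothesis finA0 : forall x, finite_set (A0 x).
Hypothesis finB0 : forall x, finite_set (B0 x).
Hypothesis finA1 : forall x, finite_set (A1 x).
Hypothesis finB1 : forall x, finite_set (B1 x).
Hypothesis oB0 : forall x y, x <> y -> orth (B0 x) (B0 y).
Hypothesis oA0B0 : forall x y, orth (A0 x) (B0 y).
Hypothesis oA1 : forall x y, x <> y -> orth (A1 x) (A1 y).
Hypothesis oB1 : forall x y, x <> y -> orth (B1 x) (B1 y).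
Hypothesis oA1B1 : forall x y, orth (A1 x) (B1 y).
(** The inclusion of [V0] in [V1] enters the finite-dimensional argument through the next two
    hypotheses. *)
Hypothesis A0A1 : forall x, A0 x `<=` linspan (A1 x).
Hypothesis B0A1 : forall x, B0 x `<=` linspan (A1 (p x) `|` B1 x `|` A1 x).
Hypothesis subN : forall x, submodule (N x).
Hypothesis pN : forall x, K x -> A1 (p x) `<=` N x.
Hypothesis sN : forall x, K x -> A1 (s x) `<=` N x.
Hypothesis indep1 : forall x w, K x ->
  linspan (A1 x `|` B1 x `|` B1 (s x)) w -> N x w -> w = 0.

(** The letter names the end at which the knot lies: [Lpart x] lives on the interval with left end
    [x], [Rpart x] on the one with right end [x]. *)
Definition Lpart x := proj (A1 x) @` B0 x.
Definition Rpart x := proj (A1 (p x)) @` B0 x.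
Definition Mpart x := A0 x `|` Lpart x `|` Rpart (s x).
Definition Tpart x := Rpart x `|` B1 x `|` Lpart x.

Definition AWspec x C := [/\ finite_set C, orthsys ip C, C `<=` linspan (A1 x),
  orth C (Mpart x) & K x -> A1 x `<=` linspan (Mpart x `|` C)].
Definition BWspec x C := [/\ finite_set C, orthsys ip C, C `<=` linspan (Tpart x),
  orth C (B0 x) & Tpart x `<=` linspan (B0 x `|` C)].

Definition AW x := xget set0 [set C | AWspec x C].
Definition BW x := xget set0 [set C | BWspec x C].

Let LA1 x : Lpart x `<=` linspan (A1 x).
Proof. by move=> _ [b _ <-]; exact: proj_span. Qed.

Let RA1 x : Rpart x `<=` linspan (A1 (p x)).
Proof. by move=> _ [b _ <-]; exact: proj_span. Qed.

Lemma Rpart_sub x : K x -> Rpart (s x) `<=` linspan (A1 x).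
Proof.
move=> Kx u Ru; have [b Bb _] := Ru.
by have := RA1 Ru; rewrite psK//; exact: B0K Bb.
Qed.

(** The spans of [A1 (p x)], [B1 x] and [A1 x] are mutually orthogonal, so the outer components of
    [b] are its projections. *)
Lemma B0_split x b : B0 x b -> exists2 b1, linspan (B1 x) b1 &
  b = proj (A1 (p x)) b + b1 + proj (A1 x) b.
Proof.
move=> Bb; have Kx := B0K Bb.
have /linspanU[_ [v [/linspanU[u [b1 [Hu Hb1 ->]]] Hv bE]]] := B0A1 Bb.
exists b1 => //; rewrite {1}bE; congr (_ + _ + _).
  apply: (proj_uniq ipP) => // w Hw.
  have -> : b - u = b1 + v by rewrite bE -[u + b1 + v]addrA [u + _]addrC addrK.
  rewrite (ipDl ipP) (orth_span ipP (orthC ipP (@oA1B1 (p x) x)) Hb1 (sub_linspan Hw)).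
  rewrite (orth_span ipP _ Hv (sub_linspan Hw)) ?addr0//.
  by apply: oA1 => /esym; exact: p_neq.
apply: (proj_uniq ipP) => // w Hw.
have -> : b - v = u + b1 by rewrite bE addrK.
rewrite (ipDl ipP) (orth_span ipP (orthC ipP (@oA1B1 x x)) Hb1 (sub_linspan Hw)).
rewrite (orth_span ipP _ Hu (sub_linspan Hw)) ?addr0//.
by apply: oA1; exact: p_neq.
Qed.

Lemma Lpart_A0 x : orth (Lpart x) (A0 x).
Proof.
move=> _ a [b Bb <-] Aa; rewrite (ip_proj ipP)//; last exact: A0A1.
by rewrite (ipC ipP); exact: oA0B0 Aa Bb.
Qed.

Lemma Rpart_A0 x : orth (Rpart x) (A0 (p x)).
Proof.
move=> _ a [b Bb <-] Aa; rewrite (ip_proj ipP)//; last exact: A0A1.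
by rewrite (ipC ipP); exact: oA0B0 Aa Bb.
Qed.

(* Both projections land in the same [A1 x]; their inner product is that of
   the orthogonal vectors [b] and [b'] of which they are the overlapping parts. *)
Lemma Lpart_Rpart x y : orth (Lpart x) (Rpart y).
Proof.
have [pyx|pyx] := pselect (p y = x); last first.
  by apply: (orthSS ipP (@LA1 x) (@RA1 y)); apply: oA1 => /esym.
move=> _ _ [b Bb <-] [b' Bb' <-]; rewrite pyx.
have Kx := B0K Bb; have Ky := B0K Bb'.
have sxy : s x = y by rewrite -pyx spK// pyx.
have xy : x <> y by move=> xy; apply: (p_neq Ky); rewrite pyx.
have [b1 Hb1] := B0_split Bb'; rewrite pyx => b'E.
rewrite (ip_proj ipP)//; last exact: proj_span.
have -> : proj (A1 x) b' = b' - b1 - proj (A1 y) b'.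
  by rewrite {2}b'E [_ + b1 + _]addrAC !addrK.
rewrite !(ipBr ipP) (oB0 xy Bb Bb').
have Bb2 := B0A1 Bb.
rewrite (orth_span ipP _ Bb2 Hb1); last first.
  apply: orthUl; [apply: orthUl|] => //; last exact: oB1.
rewrite (orth_span ipP _ Bb2 (proj_span ipP (finA1 y) b')) ?subr0//.
apply: orthUl; [apply: orthUl|]; [|exact/(orthC ipP)|exact: oA1].
by apply: oA1 => pxy; apply: (s_neq_p Kx); rewrite sxy.
Qed.

(** Different [A1] spaces are orthogonal, and so are [A1] and [B1] spaces. An [L] and an [R] part
    may share an [A1] space, which is the case of [Lpart_Rpart]; two [R] parts share one only if [p]
    agrees at [x] and [y], and [s] undoes [p]. *)
Lemma Tpart_orth x y : x <> y -> orth (Tpart x) (Tpart y).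
Proof.
move=> xy; have yx : y <> x by move=> /esym.
have RB z t : orth (Rpart z) (B1 t) by exact: (orthSS ipP (@RA1 z) (@sub_linspan _ _ _)).
have LB z t : orth (Lpart z) (B1 t) by exact: (orthSS ipP (@LA1 z) (@sub_linspan _ _ _)).
apply: orthUr; [apply: orthUr|]; (apply: orthUl; [apply: orthUl|]) => //.
- move=> u v Ru Rv; have [[b Bb _] [b' Bb' _]] := (Ru, Rv).
  apply: (orth_span ipP _ (RA1 Ru) (RA1 Rv)) => w w' Aw Aw'.
  apply: (oA1 _ Aw Aw') => pxy; apply: xy.
  rewrite -(spK (B0K Bb) (A1K Aw)) pxy spK//; first exact: B0K Bb'.
  exact: A1K Aw'.
- exact/(orthC ipP).
- exact: Lpart_Rpart.
- exact: oB1.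
- exact/(orthC ipP)/Lpart_Rpart.
- exact/(orthC ipP).
- by apply: (orthSS ipP (@LA1 x) (@LA1 y)); exact: oA1.
Qed.

Lemma AWP x : AWspec x (AW x).
Proof.
apply: (xgetPex set0).
have finL z : finite_set (Lpart z) by exact: finite_image.
have finR z : finite_set (Rpart z) by exact: finite_image.
(* Off [K], [Rpart (s x)] is not known to lie in the span of [A1 x]; the last clause of [AWspec] is
   then void and the empty set qualifies. *)
have [Kx|nKx] := pselect (K x); last first.
  by exists set0; split => //; split.
have finM : finite_set (Mpart x) by rewrite !finite_setU.
have [|C [? ? ? ? ?]] := complement_basis ipP finM (finA1 x).
  by move=> u [[/A0A1//|/LA1//]|]; exact: Rpart_sub.
by exists C.
Qed.

Lemma BWP x : BWspec x (BW x).
Proof.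
apply: (xgetPex set0).
have finT : finite_set (Tpart x).
  by rewrite !finite_setU; split; [split|]; rewrite //; exact: finite_image.
have [|C [? ? ? ? ?]] := complement_basis ipP (finB0 x) finT; last by exists C.
move=> b Bb; have [b1 Hb1 ->] := B0_split Bb.
apply: linspanD; first apply: linspanD.
- by apply: sub_linspan; left; left; exists b.
- by move: Hb1; apply: linspanS => u; left; right.
- by apply: sub_linspan; right; exists b.
Qed.

Lemma B0_Tpart x : B0 x `<=` linspan (Tpart x).
Proof.
move=> b Bb; have [b1 Hb1 ->] := B0_split Bb.
apply: linspanD; first apply: linspanD.
- by apply: sub_linspan; left; left; exists b.
- by move: Hb1; apply: linspanS => u; left; right.
- by apply: sub_linspan; right; exists b.
Qed.

Lemma AW_sub x : AW x `<=` linspan (A1 x). Proof. by have [] := AWP x. Qed.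

Lemma BW_sub x : BW x `<=` linspan (Tpart x). Proof. by have [] := BWP x. Qed.

(** The pieces of the various [Tpart y] inside the span of [A1 x] are [Lpart x] and [Rpart (s x)],
    and [Mpart x] contains both. *)
Lemma AW_Tpart x y : orth (AW x) (Tpart y).
Proof.
have [_ _ _ oM _] := AWP x.
have Kx u : linspan (A1 x) u -> u != 0 -> K x.
  move=> Hu; apply: contra_neqP => nKx; apply: linspan_set0.
  by move: Hu; apply: linspanS => w /A1K.
apply: orthUr; [apply: orthUr|].
- move=> u v Au Rv; have [b Bb _] := Rv.
  have [pyx|pyx] := pselect (p y = x); last first.
    by apply: (orth_span ipP (oA1 _) (AW_sub Au) (RA1 Rv)) => /esym.
  (* A nonzero [u] forces [K x], and only then is [s x = y] available. *)
  have [->|u0] := eqVneq u 0; first exact: ip0l.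
  apply: oM => //; right; rewrite -pyx spK//; first exact: B0K Bb.
  by rewrite pyx; exact: Kx (AW_sub Au) u0.
- exact: (orthSS ipP (@AW_sub x) (@sub_linspan _ _ _)).
- have [<-|xy] := pselect (x = y).
    by move=> u v Au Lv; apply: oM => //; left; right.
  by apply: (orthSS ipP (@AW_sub x) (@LA1 y)); exact: oA1.
Qed.

Lemma AW_orth x y : x <> y -> orth (AW x) (AW y).
Proof. by move=> xy; apply: (orthSS ipP (@AW_sub x) (@AW_sub y)); exact: oA1. Qed.

Lemma AW_BW x y : orth (AW x) (BW y).
Proof. exact: (orthSS ipP (@sub_linspan _ _ _) (@BW_sub y) (@AW_Tpart x y)). Qed.

Lemma BW_orth x y : x <> y -> orth (BW x) (BW y).
Proof. by move=> xy; exact: (orthSS ipP (@BW_sub x) (@BW_sub y) (Tpart_orth xy)). Qed.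

Lemma A0_Tpart x y : orth (A0 x) (Tpart y).
Proof.
apply: orthUr; [apply: orthUr|].
- have [<-|pyx] := pselect (p y = x); first exact/(orthC ipP)/Rpart_A0.
  by apply: (orthSS ipP (@A0A1 x) (@RA1 y)); apply: oA1 => /esym.
- exact: (orthSS ipP (@A0A1 x) (@sub_linspan _ _ _)).
- have [<-|xy] := pselect (x = y); first exact/(orthC ipP)/Lpart_A0.
  by apply: (orthSS ipP (@A0A1 x) (@LA1 y)); exact: oA1.
Qed.

Lemma A0_AW x y : orth (A0 x) (AW y).
Proof.
have [<-|xy] := pselect (x = y); last first.
  by apply: (orthSS ipP (@A0A1 x) (@AW_sub y)); exact: oA1.
have [_ _ _ oM _] := AWP x.
by apply: (orthC ipP) => u v Au Av; apply: oM => //; left; left.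
Qed.

Lemma A0_BW x y : orth (A0 x) (BW y).
Proof. exact: (orthSS ipP (@sub_linspan _ _ _) (@BW_sub y) (@A0_Tpart x y)). Qed.

Lemma B0_AW x y : orth (B0 x) (AW y).
Proof.
exact: (orthSS ipP (@B0_Tpart x) (@sub_linspan _ _ _) (orthC ipP (@AW_Tpart y x))).
Qed.

Lemma B0_BW x y : orth (B0 x) (BW y).
Proof.
have [<-|xy] := pselect (x = y).
  by have [_ _ _ oB _] := BWP x; exact/(orthC ipP).
exact: (orthSS ipP (@B0_Tpart x) (@BW_sub y) (Tpart_orth xy)).
Qed.

(** Within the span of [A1 x], orthogonality to [B0 x] and [B0 (s x)] amounts to orthogonality to
    their projections, hence [w] is orthogonal to [Mpart x]. Writing [w = m + c] makes [m]
    orthogonal to the span that contains it. *)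
Lemma AW_max x w : K x -> linspan (A1 x) w -> orth [set w] (A0 x) ->
  orth [set w] (B0 x) -> orth [set w] (B0 (s x)) -> linspan (AW x) w.
Proof.
move=> Kx Aw wA0 wB0 wB0s.
have [_ _ _ oM AM] := AWP x.
have wM : orth [set w] (Mpart x).
  move=> _ v -> [[A0v|[b Bb <-]]|[b Bb <-]]; first exact: wA0.
    by rewrite (ipC ipP) (ip_proj ipP)// (ipC ipP); exact: wB0.
  rewrite psK//; last exact: B0K Bb.
  by rewrite (ipC ipP) (ip_proj ipP)// (ipC ipP); exact: wB0s.
have /linspanU[m [c [Mm Cc wE]]] := linspan_le (AM Kx) Aw.
suff m0 : m = 0 by rewrite wE m0 add0r.
apply: (orth_self ipP Mm) => v Mv.
have -> : m = w - c by rewrite wE addrK.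
by rewrite (ipBl ipP) wM// (orth_spanl ipP oM)// subr0.
Qed.

Lemma W_gen S : (forall x, A0 x `<=` S) -> (forall x, B0 x `<=` S) ->
  (forall x, AW x `<=` S) -> (forall x, BW x `<=` S) ->
  forall x, A1 x `|` B1 x `<=` linspan S.
Proof.
move=> A0S B0S AWS BWS.
have TS x : Tpart x `<=` linspan S.
  have [_ _ _ _] := BWP x; move/subset_trans; apply.
  by apply: linspanS => u [/B0S|/BWS].
move=> x u [Au|Bu]; last by apply: (TS x); left; right.
have [_ _ _ _ /(_ (A1K Au) _ Au)] := AWP x.
apply: linspan_le => {Au}u [[[/A0S|Lu]|Ru]|/AWS]; try exact: sub_linspan.
  by apply: (TS x); right.
by apply: (TS (s x)); left; left.
Qed.

Lemma Tpart_span x w : linspan (Tpart x) w ->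
  exists r b l,
    [/\ linspan (Rpart x) r, linspan (B1 x) b, linspan (Lpart x) l & w = r + b + l].
Proof. by move=> /linspanU[_ [l [/linspanU[r [b [? ? ->]]] ? ->]]]; exists r, b, l. Qed.

(** On the interval from [x] to [s x] only [al], [b], [l], [r'] and [b'] survive, and fine
    independence makes their sum zero. What is left, [r] and [l'], lies both in the span of an [A1]
    and in that of a [BW], which meet only in zero. *)
Lemma W_indep x w : K x ->
  linspan (AW x `|` BW x `|` BW (s x)) w -> N x w -> w = 0.
Proof.
move=> Kx /linspanU[_ [g [/linspanU[al [be [Hal Hbe ->]]] Hg ->]]] Nw.
have [r [b [l [Hr Hb Hl beE]]]] := Tpart_span (linspan_le (@BW_sub x) Hbe).
have [r' [b' [l' [Hr' Hb' Hl' gE]]]] := Tpart_span (linspan_le (@BW_sub (s x)) Hg).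
have Ar : linspan (A1 (p x)) r by exact: linspan_le (@RA1 x) _ Hr.
have Al' : linspan (A1 (s x)) l' by exact: linspan_le (@LA1 (s x)) _ Hl'.
have Hal1 : linspan (A1 x) al by exact: linspan_le (@AW_sub x) _ Hal.
have Hl1 : linspan (A1 x) l by exact: linspan_le (@LA1 x) _ Hl.
have Hr1 : linspan (A1 x) r' by exact: linspan_le (Rpart_sub Kx) _ Hr'.
pose u := al + l + r'.
have Hu : linspan (A1 x) u by rewrite /u; do 2?apply: linspanD.
have wE : al + be + g - r - l' = u + b + b'.
  have -> : al + be + g = al + l + r' + b + b' + l' + r.
    by rewrite beE gE [LHS](AC (1*3*3) (1*4*5*3*6*7*2)).
  by rewrite !addrK.
have ubb : u + b + b' = 0.
  apply: (indep1 Kx).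
    apply: linspanD; first apply: linspanD.
    - by move: Hu; apply: linspanS => v; left; left.
    - by move: Hb; apply: linspanS => v; left; right.
    - by move: Hb'; apply: linspanS => v; right.
  rewrite -wE; apply: submoduleB; [exact: subN| |].
    apply: submoduleB; [exact: subN|exact: Nw|].
    by move: Ar; apply: linspan_sub; [exact: subN|exact: pN].
  by move: Al'; apply: linspan_sub; [exact: subN|exact: sN].
have [u0 b0 b'0] : [/\ u = 0, b = 0 & b' = 0].
  apply: (orth3_eq0 ipP) => //.
  - exact: (orth_span ipP (@oA1B1 x x)).
  - exact: (orth_span ipP (@oA1B1 x (s x))).
  - by apply: (orth_span ipP (@oB1 x (s x) _)) => // /esym; exact: s_neq.
(* The three summands of [u] share the span of [A1 x] but are mutually orthogonal; for the last two
   this is [Lpart_Rpart]. *)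
have [al0 l0 r'0] : [/\ al = 0, l = 0 & r' = 0].
  apply: (orth3_eq0 ipP) => //.
  - by apply: (orth_span ipP (@AW_Tpart x x)) => //; move: Hl; apply: linspanS => v; right.
  - apply: (orth_span ipP (@AW_Tpart x (s x))) => //.
    by move: Hr'; apply: linspanS => v; left; left.
  - exact: (orth_span ipP (@Lpart_Rpart x (s x))).
(* Such a [v] is orthogonal to the coarse vectors, so [AW_max] puts it in the span of [AW y], which
   is orthogonal to [BW z]. *)
have kill y z v : linspan (A1 y) v -> linspan (BW z) v -> v = 0.
  move=> Ay Bz; apply: contrapT => v0.
  have Ky : K y.
    apply: contrapT => nKy; apply: v0; apply: linspan_set0.
    by move: Ay; apply: linspanS => t /A1K.
  have vB0 t : orth [set v] (B0 t).
    by move=> _ c -> Bc; exact: (orth_spanl ipP (orthC ipP (@B0_BW t z)) Bz Bc).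
  apply: v0; apply: (ip_eq0 ipP).
  apply: (orth_span ipP (@AW_BW y z) _ Bz); apply: AW_max => //.
  by move=> _ c -> Ac; exact: (orth_spanl ipP (orthC ipP (@A0_BW y z)) Bz Ac).
have be0 : be = 0.
  apply: (kill (p x) x) => //.
  by rewrite beE b0 l0 !addr0.
have g0 : g = 0.
  apply: (kill (s x) (s x)) => //.
  by rewrite gE b'0 r'0 !add0r.
by rewrite al0 be0 g0 !addr0.
Qed.

Lemma two_scale_split : exists AW BW, two_scale_complement ip K s p A0 B0 A1 B1 N AW BW.
Proof.
exists AW, BW; split.
- by move=> x; have [] := AWP x.
- by move=> x; have [] := BWP x.
- by move=> x; have [] := AWP x.
- by move=> x; have [] := BWP x.
- exact: AW_sub.
- move=> x u /BW_sub; apply: linspan_le => v [[/RA1|Bv]|/LA1].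
  + by apply: linspanS => w Aw; left; left.
  + by apply: sub_linspan; left; right.
  + by apply: linspanS => w Aw; right.
- move=> x u Bu; apply: contrapT => nB.
  have Tx v : Tpart x v -> set0 v.
    by move=> [[[b Bb _]|Bv]|[b Bb _]]; apply: nB;
      [exists b; left|exists v; right|exists b; left].
  have [_ [BW0 _] _ _ _] := BWP x; apply: BW0.
  by rewrite -(linspan_set0 (linspanS Tx (BW_sub Bu))).
- exact: AW_orth.
- exact: BW_orth.
- exact: AW_BW.
- exact: A0_AW.
- exact: A0_BW.
- exact: B0_AW.
- exact: B0_BW.
- exact: AW_max.
- exact: W_gen.
- exact: W_indep.
Qed.

End two_scale.

(** * The space L2 *)

Section L2_functions.
Context {R : realType} {J : interval R}.
Local Notation mu := (lebesgue_on J).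
Local Notation T := (measurableTypeR R).
Implicit Types f g h : L2 J.


Lemma aeI (P Q : T -> Prop) : (\forall x \ae mu, P x) -> (\forall x \ae mu, Q x) ->
  \forall x \ae mu, P x /\ Q x.
Proof. by move=> aP aQ; apply: filterS2 aP aQ => x Px Qx; split. Qed.

Lemma aeS (P Q : T -> Prop) : (\forall x \ae mu, P x) -> (forall x, P x -> Q x) ->
  \forall x \ae mu, Q x.
Proof. by move=> + PQ; exact: filterS. Qed.

Lemma Lnorm2E (f : T -> R) :
  ('N[mu]_2%:E[EFin \o f] `^ 2 = \int[mu]_x (f x ^+ 2)%:E)%E.
Proof.
rewrite poweR_Lnorm//; apply: eq_integral => x _ /=.
by rewrite powR_mulrn// real_normK// num_real.
Qed.

Lemma Lfun2P (f : T -> R) : measurable_fun setT f ->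
  (\int[mu]_x (f x ^+ 2)%:E < +oo)%E -> f \in Lfun mu 2%:E.
Proof.
move=> mf; rewrite -Lnorm2E => nf; rewrite inE; apply/andP; split; rewrite inE//=.
by apply: lty_poweRy nf.
Qed.

Lemma L2_Lfun f : (f : T -> R) \in Lfun mu 2%:E.
Proof.
case: f => f [[ff]]; rewrite inE; apply/andP; split; rewrite inE//=.
exact: (@measurable_funPT _ _ _ _ (repr f)).
Qed.

Lemma L2_eqP f g : ae_eq mu setT f g -> f = g.
Proof.
case: f g => f [[pf]] [g [[pg]]]; rewrite /L2_repr/= => fg.
have fE : f = g.
  rewrite -[f]reprK -[g]reprK; apply/eqmodP/asboolP; exact: fg.
by subst g; rewrite (Prop_irrelevance pf pg).
Qed.

(** Passing to the quotient replaces [f] by another representative, so finiteness of the norm is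
    carried over along almost everywhere equality. *)
Lemma L2_exists (f : T -> R) : f \in Lfun mu 2%:E ->
  exists g : L2 J, ae_eq mu setT g f.
Proof.
rewrite inE => /andP[]; rewrite !inE/= => mf nf.
have mf' : (f : T -> T) \in @mfun _ _ T T by rewrite inE.
pose F : {mfun T >-> T} := mfun_Sub mf'.
pose G : {mfun_ mu, T >-> T} := (\pi_({mfun_ mu, T >-> T}) F)%qT.
have GF : ae_eq mu setT (repr G : T -> R) f.
  by have /eqmodP/asboolP : (repr G = F %[mod {mfun_ mu, T >-> T}])%qT by rewrite reprK.
have nG : finite_norm mu 2%:E G.
  have mG : measurable_fun setT (repr G : T -> R).
    exact: (@measurable_funPT _ _ _ _ (repr G)).
  have := Lfun2P mG; rewrite inE => H.
  suff /H/andP[_] : (\int[mu]_x (repr G x ^+ 2)%:E < +oo)%E.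
    by rewrite inE.
  have msq (h : T -> R) : measurable_fun setT h ->
      measurable_fun setT (fun x => (h x ^+ 2)%:E).
    by move=> mh; apply/measurable_EFinP; exact: measurable_funX.
  rewrite (@ae_eq_integral _ _ _ mu _ (fun x => (f x ^+ 2)%:E)); last 4 first.
  - by [].
  - exact: msq.
  - exact: msq.
  - by apply: filterS GF => x /[apply] /= ->.
  by rewrite -Lnorm2E; exact: poweR_lty.
exists (LebesgueSpace.Pack (LebesgueSpace.Class
  (isFinLebesgue.Build _ _ _ _ _ (lee1n 2) _ nG))).
exact: GF.
Qed.


Lemma Lfun2_lin c (f g : T -> R) : f \in Lfun mu 2%:E -> g \in Lfun mu 2%:E ->
  (fun x => c * f x + g x) \in Lfun mu 2%:E.
Proof. by move=> Hf Hg; have := (Lfun_submod_closed mu (lee1n 2)).2 c f g Hf Hg. Qed.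

Lemma Lfun2_cst0 : (cst 0 : T -> R) \in Lfun mu 2%:E.
Proof. exact: (Lfun_submod_closed mu (lee1n 2)).1. Qed.

(** Both module operations come from this one, with [1] as coefficient or zero as last argument. The
    class is picked by choice and unique by [L2_eqP]. *)
Definition L2_lin c f g : L2 J := sval (cid (L2_exists (Lfun2_lin c (L2_Lfun f) (L2_Lfun g)))).

Lemma L2_linE c f g : ae_eq mu setT (L2_lin c f g) (fun x => c * f x + g x).
Proof. exact: (svalP (cid (L2_exists _))). Qed.

Definition L2_zero : L2 J := sval (cid (L2_exists Lfun2_cst0)).

Lemma L2_zeroE : ae_eq mu setT L2_zero (cst 0).
Proof. exact: (svalP (cid (L2_exists _))). Qed.

Definition L2_add f g := L2_lin 1 f g.
Definition L2_scale c f := L2_lin c f L2_zero.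
Definition L2_opp f := L2_scale (-1) f.

Lemma L2_addE f g : ae_eq mu setT (L2_add f g) (f \+ g).
Proof. by apply: filterS (L2_linE 1 f g) => x /[apply] ->; rewrite mul1r. Qed.

Lemma L2_scaleE c f : ae_eq mu setT (L2_scale c f) (fun x => c * f x).
Proof.
apply: filterS2 (L2_linE c f L2_zero) L2_zeroE => x e1 e2 _.
by rewrite (e1 I) (e2 I) /= addr0.
Qed.

Fact L2_addA : associative L2_add.
Proof.
move=> f g h; apply: L2_eqP.
have H := aeI (aeI (L2_addE f (L2_add g h)) (L2_addE g h))
  (aeI (L2_addE (L2_add f g) h) (L2_addE f g)).
apply: (aeS H) => x [[e1 e2] [e3 e4]] _.
by rewrite (e1 I) /= (e2 I) /= (e3 I) /= (e4 I) /= addrA.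
Qed.

Fact L2_addC : commutative L2_add.
Proof.
move=> f g; apply: L2_eqP; have H := aeI (L2_addE f g) (L2_addE g f).
by apply: (aeS H) => x [e1 e2] _; rewrite (e1 I) /= (e2 I) /= addrC.
Qed.

Fact L2_add0 : left_id L2_zero L2_add.
Proof.
move=> f; apply: L2_eqP; have H := aeI (L2_addE L2_zero f) L2_zeroE.
by apply: (aeS H) => x [e1 e2] _; rewrite (e1 I) /= (e2 I) /= add0r.
Qed.

Fact L2_addN : left_inverse L2_zero L2_opp L2_add.
Proof.
move=> f; apply: L2_eqP.
have H := aeI (aeI (L2_addE (L2_opp f) f) L2_zeroE) (L2_scaleE (-1) f).
by apply: (aeS H) => x [[e1 e2] e3] _; rewrite (e1 I) /= (e2 I) /= (e3 I) /= mulN1r addNr.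
Qed.

HB.instance Definition _ := gen_eqMixin (L2 J).
HB.instance Definition _ := gen_choiceMixin (L2 J).
HB.instance Definition _ := GRing.isZmodule.Build (L2 J) L2_addA L2_addC L2_add0 L2_addN.

Fact L2_scaleA a b f : L2_scale a (L2_scale b f) = L2_scale (a * b) f.
Proof.
apply: L2_eqP.
have H := aeI (L2_scaleE a (L2_scale b f)) (aeI (L2_scaleE b f) (L2_scaleE (a * b) f)).
by apply: (aeS H) => x [e1 [e2 e3]] _; rewrite (e1 I) /= (e2 I) /= (e3 I) /= mulrA.
Qed.

Fact L2_scale1 : left_id 1 L2_scale.
Proof.
move=> f; apply: L2_eqP; have H := L2_scaleE 1 f.
by apply: (aeS H) => x e1 _; rewrite (e1 I) /= mul1r.
Qed.

Fact L2_scaleDr : right_distributive L2_scale +%R.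
Proof.
move=> a f g; apply: L2_eqP.
have H := aeI (aeI (L2_scaleE a (L2_add f g)) (L2_addE f g))
  (aeI (L2_addE (L2_scale a f) (L2_scale a g)) (aeI (L2_scaleE a f) (L2_scaleE a g))).
apply: (aeS H) => x [[e1 e2] [e3 [e4 e5]]] _.
by rewrite (e1 I) /= (e2 I) /= (e3 I) /= (e4 I) /= (e5 I) /= mulrDr.
Qed.

Fact L2_scaleDl f : {morph L2_scale^~ f : a b / a + b}.
Proof.
move=> a b; apply: L2_eqP.
have H := aeI (L2_scaleE (a + b) f)
  (aeI (L2_addE (L2_scale a f) (L2_scale b f)) (aeI (L2_scaleE a f) (L2_scaleE b f))).
apply: (aeS H) => x [e1 [e2 [e3 e4]]] _.
by rewrite (e1 I) /= (e2 I) /= (e3 I) /= (e4 I) /= mulrDl.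
Qed.

HB.instance Definition _ := GRing.Zmodule_isLmodule.Build R (L2 J)
  L2_scaleA L2_scale1 L2_scaleDr L2_scaleDl.

Lemma L2_0E : \forall x \ae mu, (0 : L2 J) x = 0.
Proof. by apply: (aeS L2_zeroE) => x; exact. Qed.

Lemma L2_DE f g : \forall x \ae mu, (f + g : L2 J) x = f x + g x.
Proof. by apply: (aeS (L2_addE f g)) => x; exact. Qed.

Lemma L2_ZE c f : \forall x \ae mu, (c *: f : L2 J) x = c * f x.
Proof. by apply: (aeS (L2_scaleE c f)) => x; exact. Qed.

Lemma L2_BE f g : \forall x \ae mu, (f - g : L2 J) x = f x - g x.
Proof.
rewrite -scaleN1r; have H := aeI (L2_DE f (-1 *: g)) (L2_ZE (-1) g).
by apply: (aeS H) => x [-> ->]; rewrite mulN1r.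
Qed.

Lemma lincombE n (c : 'I_n -> R) (phi : 'I_n -> L2 J) :
  \forall x \ae mu, (\sum_(i < n) c i *: phi i : L2 J) x = lincomb c phi x.
Proof.
elim: n c phi => [|n IH] c phi.
  by rewrite big_ord0; apply: (aeS L2_0E) => x ->; rewrite /lincomb big_ord0.
rewrite big_ord_recr.
pose c' := c \o widen_ord (leqnSn n); pose phi' := phi \o widen_ord (leqnSn n).
have H := aeI (L2_DE (\sum_(i < n) c' i *: phi' i) (c ord_max *: phi ord_max))
  (aeI (IH c' phi') (L2_ZE (c ord_max) (phi ord_max))).
apply: (aeS H) => x [-> [-> ->]].
by rewrite /lincomb big_ord_recr.
Qed.

Lemma L2_mul_integrable f g : mu.-integrable setT (EFin \o (fun x => f x * g x)).
Proof. exact/Lfun1_integrable/(Lfun2_mul_Lfun1 (L2_Lfun f) (L2_Lfun g)). Qed.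

Lemma measurable_L2 f : measurable_fun setT (f : T -> R).
Proof. by have := L2_Lfun f; rewrite inE => /andP[]; rewrite inE. Qed.

Lemma L2_innerE f g (f' g' : T -> R) : ae_eq mu setT f f' -> ae_eq mu setT g g' ->
  measurable_fun setT f' -> measurable_fun setT g' ->
  L2_inner f g = \int[mu]_x (f' x * g' x).
Proof.
move=> ff gg mf mg; congr fine; apply: ae_eq_integral => //.
- by apply/measurable_EFinP/measurable_funM; exact: measurable_L2.
- by apply/measurable_EFinP/measurable_funM.
- by apply: filterS2 ff gg => x + + _ => /(_ I) -> /(_ I) ->.
Qed.

Lemma L2_inner_sqr f : (\int[mu]_x (f x ^+ 2)%:E = (L2_inner f f)%:E)%E.
Proof.
rewrite /L2_inner /Rintegral fineK//; apply: integrable_fin_num => //.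
exact: L2_mul_integrable.
Qed.

Lemma L2_inner_product : inner_product (@L2_inner R J).
Proof.
split.
- by move=> f g; apply: eq_Rintegral => x _; rewrite mulrC.
- move=> c f g h.
  have Ef : ae_eq mu setT (c *: f + g : L2 J) (fun x => c * f x + g x).
    have H := aeI (L2_DE (c *: f) g) (L2_ZE c f).
    by apply: (aeS H) => x [-> ->].
  have mf : measurable_fun setT (fun x : T => c * f x + g x).
    by apply: measurable_funD; [apply: measurable_funM|]; rewrite //; exact: measurable_L2.
  rewrite (L2_innerE Ef (ae_eq_refl _ _ _) mf (measurable_L2 h)).
  under eq_Rintegral do rewrite mulrDl -mulrA.
  have ifh : mu.-integrable setT (EFin \o (fun x => c * (f x * h x))).
    exact: (integrableZl _ c (L2_mul_integrable f h)).
  rewrite (RintegralD _ ifh (L2_mul_integrable g h))//.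
  by rewrite RintegralZl//; exact: L2_mul_integrable.
- by move=> f; apply: Rintegral_ge0 => x _; rewrite -expr2 sqr_ge0.
- move=> f f0; apply: L2_eqP.
  have H : ae_eq mu setT (EFin \o (fun x => f x ^+ 2)) (cst 0%E).
    apply/ae_eq_integral_abs => //.
      by apply/measurable_EFinP/measurable_funX; exact: measurable_L2.
    rewrite -[RHS](congr1 EFin f0) -L2_inner_sqr; apply: eq_integral => x _ /=.
    by rewrite ger0_norm ?sqr_ge0.
  apply: (aeS (aeI L2_0E H)) => x [-> /(_ I) [] /eqP].
  by rewrite sqrf_eq0 => /eqP.
Qed.

Lemma L2_distE f g (e : R) : 0 < e ->
  (L2_dist f g < e%:E)%E <-> L2_inner (f - g) (f - g) < e ^+ 2.
Proof.
move=> e0.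
have E : (L2_dist f g `^ 2 = (L2_inner (f - g) (f - g))%:E)%E.
  rewrite /L2_dist Lnorm2E -L2_inner_sqr; apply: ae_eq_integral => //.
  - by apply/measurable_EFinP/measurable_funX/measurable_funB; exact: measurable_L2.
  - by apply/measurable_EFinP/measurable_funX; exact: measurable_L2.
  - by apply: (aeS (L2_BE f g)) => x /= -> _.
have d0 : (0 <= L2_dist f g)%E by exact: Lnorm_ge0.
rewrite -lte_fin -E; case: (L2_dist f g) d0 => [r| |]//= => r0.
  rewrite lee_fin in r0.
  by rewrite !lte_fin powR_mulrn// ltr_pXn2r ?nnegrE ?(ltW e0).
by rewrite pnatr_eq0.
Qed.

Lemma clspanE (Phi : set (L2 J)) : clspan Phi = clos (@L2_inner R J) (linspan Phi).
Proof.
have sE : L2_span Phi = linspan Phi.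
  apply/seteqP; split=> f [n [phi [c [Pphi fE]]]]; exists n, phi, c; split => //.
    apply: L2_eqP; apply: (aeS (aeI fE (lincombE c phi))) => x [e ->] _.
    exact: e.
  by rewrite fE; apply: (aeS (lincombE c phi)) => x -> _.
rewrite /clspan sE; apply/seteqP; split=> f cf e e0.
  have se0 : 0 < Num.sqrt e by rewrite sqrtr_gt0.
  by have [g Pg /(L2_distE _ _ se0)] := cf _ se0; rewrite sqr_sqrtr ?ltW//; exists g.
have [|g Pg fg] := cf (e ^+ 2); first by rewrite exprn_gt0.
by exists g => //; apply/L2_distE.
Qed.

End L2_functions.

(** * Supports, and projection onto a closed span *)

Section rational_intervals.
Context {R : realType}.

(** A countable family of compact intervals, so that statements holding almost everywhere on each
    can be combined. Numbers that code no pair of rationals give the empty set. *)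
Definition rat_itv (n : nat) : set R :=
  if unpickle n is Some (l, r) then [set` `[ratr l, ratr r]] else set0.

Lemma rat_itv_ex (u t w : R) : u < t < w ->
  exists2 n, rat_itv n t & rat_itv n `<=` `]u, w[.
Proof.
move=> /andP[ut tw].
have [l lin] := rat_in_itvoo ut; have [r rin] := rat_in_itvoo tw.
exists (pickle (l, r)); rewrite /rat_itv pickleK /=.
  by rewrite in_itv /= !ltW ?(itvP lin) ?(itvP rin).
move=> s /=; rewrite !in_itv /= => /andP[ls sr].
by rewrite (lt_le_trans _ ls) ?(itvP lin)// (le_lt_trans sr) ?(itvP rin).
Qed.

Lemma rat_itv_compact n : exists x y, rat_itv n = [set` `[x, y]].
Proof.
rewrite /rat_itv; case: unpickle => [[l r]|]; first by exists (ratr l), (ratr r).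
by exists 1, 0; rewrite set_itv_ge// bnd_simp -ltNge ltr01.
Qed.

End rational_intervals.

Section vanishing.
Context {R : realType} {J : interval R}.
Local Notation mu := (lebesgue_on J).
Local Notation T := (measurableTypeR R).
Implicit Types (f g h phi : L2 J) (K : set R) (Phi : set (L2 J)).

Lemma ae_neq (c : R) : \forall x \ae mu, x <> c.
Proof.
have mc : measurable ([set c] : set T) by exact: measurable_set1.
exists [set c]; split => //.
  apply/eqP; rewrite -measure_le0 /lebesgue_on /= /mrestr.
  rewrite -(lebesgue_measure_set1 c); apply: le_measure; rewrite ?inE//.
  - by apply: measurableI => //; exact: measurable_itv.
by move=> x /= /contrapT.
Qed.

Lemma ae_mem : \forall x \ae mu, x \in J.
Proof.
have mJ : measurable (~` [set` J] : set T) by apply: measurableC; exact: measurable_itv.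
exists (~` [set` J]); split => //.
by rewrite /lebesgue_on /= /mrestr setICl measure0.
Qed.

(** A largest or smallest element of [J], if there is one, is a null set; every other point of [J]
    has elements of [J] on both sides. *)
Lemma ae_interior : \forall x \ae mu, exists u w, [/\ u \in J, w \in J & u < x < w].
Proof.
have H1 : \forall x \ae mu, exists2 w, w \in J & x < w.
  have [[c [cJ cmax]]|nmax] := pselect (exists c, c \in J /\ forall w, w \in J -> w <= c).
    apply: (aeS (aeI ae_mem (ae_neq c))) => x [xJ xc]; exists c => //.
    by rewrite lt_neqAle cmax// andbT; apply/eqP.
  apply: (aeS ae_mem) => x xJ; apply: contrapT => nw; apply: nmax.
  exists x; split => // w wJ; rewrite leNgt; apply/negP => xw; apply: nw.
  by exists w.
have H2 : \forall x \ae mu, exists2 u, u \in J & u < x.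
  have [[c [cJ cmin]]|nmin] := pselect (exists c, c \in J /\ forall w, w \in J -> c <= w).
    apply: (aeS (aeI ae_mem (ae_neq c))) => x [xJ xc]; exists c => //.
    by rewrite lt_neqAle cmin// andbT eq_sym; apply/eqP.
  apply: (aeS ae_mem) => x xJ; apply: contrapT => nw; apply: nmin.
  exists x; split => // w wJ; rewrite leNgt; apply/negP => xw; apply: nw.
  by exists w.
by apply: (aeS (aeI H1 H2)) => x [[w wJ xw] [u uJ ux]]; exists u, w; rewrite ux.
Qed.

Lemma ae_rat_itv : \forall x \ae mu, exists2 k, rat_itv k `<=` [set` J] & rat_itv k x.
Proof.
apply: (aeS ae_interior) => x [u [w [uJ wJ uxw]]].
have [k kx kuw] := rat_itv_ex uxw; exists k => // t /kuw /=.
rewrite in_itv /= => /andP[/ltW ut /ltW tw].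
by apply: (interval_is_interval uJ wJ); rewrite ut.
Qed.

Lemma vanishes_submodule K : submodule (@vanishes_on R J K).
Proof.
split; first by apply: (aeS L2_0E) => x -> _.
move=> c f g f0 g0.
apply: (aeS (aeI (aeI f0 g0) (aeI (L2_DE (c *: f) g) (L2_ZE c f)))).
by move=> x [[/= f0x g0x] [-> ->]] Kx; rewrite f0x// g0x// mulr0 addr0.
Qed.

Lemma vanishesS K K' f : K `<=` K' -> vanishes_on K' f -> vanishes_on K f.
Proof. by move=> KK; exact: ae_eq_subset. Qed.

Lemma vanishes_setT f : vanishes_on setT f -> f = 0.
Proof.
by move=> f0; apply: L2_eqP; apply: (aeS (aeI f0 L2_0E)) => x [/= fx ->].
Qed.

Lemma vanishes_inner f g : (\forall x \ae mu, f x = 0 \/ g x = 0) -> L2_inner f g = 0.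
Proof.
move=> fg; rewrite /L2_inner /Rintegral.
rewrite (@ae_eq_integral _ _ _ mu _ (cst 0%E)) ?integral_cst ?mul0e//.
  by apply/measurable_EFinP/measurable_funM; exact: measurable_L2.
by apply: (aeS fg) => x [->|->] _; rewrite ?mul0r ?mulr0.
Qed.

(** A point off the support has a rational interval around it on which [f] vanishes, and only
    countably many null sets arise this way. *)
Lemma vanishes_off_supp f : vanishes_on (~` supp f) f.
Proof.
have H : \forall x \ae mu, forall n, vanishes_on (@rat_itv R n) f -> rat_itv n x -> f x = 0.
  apply: ae_foralln => n.
  have [fn|nfn] := pselect (vanishes_on (@rat_itv R n) f).
    by apply: (aeS fn) => x /= fx _ /fx.
  by apply: aeW => x /nfn.
apply: (aeS H) => x /= Hx xf.
have : exists2 U, nbhs x U & vanishes_on U f.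
  by apply: contrapT => nU; apply: xf => U xU fU; apply: nU; exists U.
move=> [U /nbhs_ballP[e /= e0 eU] fU].
have /rat_itv_ex[n nx nU] : x - e < x < x + e by rewrite ltrBlDr !ltrDl e0.
apply: (Hx n) => //; apply: vanishesS fU => t /nU /= /[!in_itv] /= tU.
by apply: eU; rewrite /ball/= ltr_distlC.
Qed.

Lemma nbhs_EFin_lt (y : \bar R) (t : R) : (y < t%:E)%E -> \forall s \near t, (y < s%:E)%E.
Proof.
case: y => [r| |]// rt; last by near=> s; rewrite ltNyr.
by rewrite lte_fin in rt; near=> s; rewrite lte_fin; near: s; exact: lt_nbhsr.
Unshelve. all: by end_near. Qed.

Lemma nbhs_EFin_gt (y : \bar R) (t : R) : (t%:E < y)%E -> \forall s \near t, (s%:E < y)%E.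
Proof.
case: y => [r| |]// rt; last by near=> s; rewrite ltry.
by rewrite lte_fin in rt; near=> s; rewrite lte_fin; near: s; exact: lt_nbhsl.
Unshelve. all: by end_near. Qed.

(** The complement of [eitv x y] is open, so it is itself the neighbourhood that keeps its points
    off the support. *)
Lemma supp_eitv f (x y : \bar R) : supp f `<=` eitv x y <-> vanishes_on (~` eitv x y) f.
Proof.
split=> [sf|vf t tf].
  by apply: vanishesS (@vanishes_off_supp f); exact: subsetC.
apply: contrapT => txy; apply: (tf (~` eitv x y)) => //.
move/negP : txy; rewrite negb_and -!ltNge => /orP[tx|yt].
  apply: filterS (nbhs_EFin_gt tx) => s sx /=; rewrite /eitv/= => /andP[].
  by rewrite leNgt sx.
apply: filterS (nbhs_EFin_lt yt) => s ys /=; rewrite /eitv/= => /andP[_].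
by rewrite leNgt ys.
Qed.

(** Fatou's lemma for [(u m - g) ^+ 2], whose lower limit is [(w - g) ^+ 2] almost everywhere. Here
    [w] is a mere measurable function, because the bound serves to show that it belongs to L2. *)
Lemma L2_fatou (u : nat -> L2 J) (w : T -> R) g (C : R) : measurable_fun setT w ->
  (\forall x \ae mu, (fun m => u m x) @ \oo --> w x) ->
  (forall m, L2_inner (u m - g) (u m - g) <= C) ->
  (\int[mu]_x ((w x - g x) ^+ 2)%:E <= C%:E)%E.
Proof.
move=> mw uw uC.
pose h m x := (((u m x - g x) ^+ 2)%:E : \bar R).
have mh m : measurable_fun setT (h m).
  by apply/measurable_EFinP/measurable_funX/measurable_funB; exact: measurable_L2.
have -> : (\int[mu]_x ((w x - g x) ^+ 2)%:E = \int[mu]_x limn_einf (h ^~ x))%E.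
  apply: ae_eq_integral => //.
  - by apply/measurable_EFinP/measurable_funX/measurable_funB => //; exact: measurable_L2.
  - have -> : (fun x => limn_einf (h ^~ x)) =
        (-%E \o (fun x => limn_esup (fun n => - h n x)))%E.
      by [].
    apply: measurableT_comp => //.
    apply: measurable_fun_limn_esup => n.
    exact: (measurableT_comp (@oppe_measurable R setT) (mh n)).
  - apply: (aeS uw) => x ux _.
    have /cvg_limn_einf_sup[-> //] : h ^~ x @ \oo --> ((w x - g x) ^+ 2)%:E.
    by apply: cvg_EFin; [exact: nearW|apply: cvgM; apply: cvgB => //; exact: cvg_cst].
apply: le_trans (fatou _ _ _ _) _ => //; first by move=> n x _; rewrite lee_fin sqr_ge0.
apply: le_trans (limn_einf_sup _) _; rewrite limn_esup_lim.
apply: lime_le; first exact: is_cvg_esups.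
apply: nearW => n; apply: ge_ereal_sup => _ [m _ <-].
rewrite (_ : (\int[mu]_x h m x = (L2_inner (u m - g) (u m - g))%:E)%E) ?lee_fin//.
rewrite -L2_inner_sqr; apply: ae_eq_integral; [by []|exact: mh| |].
  by apply/measurable_EFinP/measurable_funX; exact: measurable_L2.
by apply: (aeS (L2_BE (u m) g)) => x -> _.
Qed.

Lemma limn_esup_fine (c : nat -> R) (l : R) : c @ \oo --> l ->
  fine (limn_esup (fun m => (c m)%:E)) = l.
Proof.
move=> cl; have /cvg_limn_einf_sup[_ ->] // : (fun m => (c m)%:E) @ \oo --> l%:E.
by apply: cvg_EFin; [exact: nearW|].
Qed.

(** * Projection onto the closed span of a locally finite orthogonal system *)

Section projection.
Variables (Phi : set (L2 J)).
Hypothesis lfPhi : locally_finite Phi.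
Hypothesis oPhi : forall f g, Phi f -> Phi g -> f <> g -> L2_inner f g = 0.
Variable f : L2 J.
Local Notation ip := (@L2_inner R J).
Local Notation ipP := (@L2_inner_product R J).

Let good k := @rat_itv R k `<=` [set` J].
(** Indexed by the first [n] rational intervals inside [J]: local finiteness makes [F n] finite, and
    the [F n] exhaust [Phi] up to the zero function. *)
Let F n : set (L2 J) := [set phi | Phi phi /\
  exists2 k, (k < n)%N & good k /\ ~ vanishes_on (rat_itv k) phi].

Let finF n : finite_set (F n).
Proof.
apply: (@sub_finite_set _ _ (\bigcup_(k in `I_n)
    [set phi | Phi phi /\ (good k /\ ~ vanishes_on (rat_itv k) phi)])).
  by move=> phi [Pphi [k kn kphi]]; exists k.
apply: bigcup_finite; first exact: finite_II.
move=> k _; have [gk|ngk] := pselect (good k); last first.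
  by apply: (@sub_finite_set _ _ set0) => // phi [_ []].
have [x [y xyE]] := @rat_itv_compact R k.
have := lfPhi (x := x) (y := y); rewrite -xyE => /(_ gk).
by apply: sub_finite_set => phi [? []].
Qed.

Let FS n m : (n <= m)%N -> F n `<=` F m.
Proof.
by move=> nm phi [Pphi [k kn ?]]; split => //; exists k => //; exact: leq_trans nm.
Qed.

Let v n : L2 J := proj ip (F n) f.

Let vF n : linspan (F n) (v n). Proof. exact: (proj_span ipP (finF n) f). Qed.

Let v_orth n m u : (n <= m)%N -> linspan (F n) u -> ip (v m - v n) u = 0.
Proof.
move=> nm Fu; rewrite (ipBl ipP) (ip_proj ipP (finF n))// (ip_proj ipP (finF m)) ?subrr//.
exact: linspanS (FS nm) _ Fu.
Qed.

(** Since [Phi] is orthogonal, enlarging [F n] changes the projection only by new vectors; these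
    vanish on the good intervals of index below [n], whence [v_stable]. *)
Let v_sub n m : (n <= m)%N -> linspan (F m `\` F n) (v m - v n).
Proof.
move=> nm; apply: (clos_finite ipP (S := F m)).
- exact: finite_setD.
- by move=> phi [].
- by move=> g h [Pg _] [Ph _]; exact: oPhi.
- apply: (sub_clos ipP); apply: linspanB => //.
  by move: (vF n); apply: linspanS; exact: FS.
- move=> g Fg nFg; apply: (v_orth nm); apply: sub_linspan.
  by apply: contrapT => nFng; apply: nFg.
Qed.

Let v_stable n m k : (n <= m)%N -> (k < n)%N -> good k ->
  vanishes_on (rat_itv k) (v m - v n).
Proof.
move=> nm kn gk; move: (v_sub nm); apply: linspan_sub; first exact: vanishes_submodule.
by move=> phi [[Pphi _] nF]; apply: contrapT => nv; apply: nF; split => //; exists k.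
Qed.

Let v_cvg : \forall x \ae mu, exists l : R, (fun m => v m x) @ \oo --> l.
Proof.
have H : \forall x \ae mu, forall n m k, (n <= m)%N -> (k < n)%N -> good k ->
    rat_itv k x -> v m x = v n x.
  apply: ae_foralln => n; apply: ae_foralln => m; apply: ae_foralln => k.
  have [[nm [kn gk]]|h] := pselect ((n <= m)%N /\ (k < n)%N /\ good k); last first.
    by apply: aeW => x nm kn gk; exfalso; apply: h.
  apply: (aeS (aeI (v_stable nm kn gk) (L2_BE (v m) (v n)))) => x [/= h1 h2] _ _ _ kx.
  by apply/eqP; rewrite -subr_eq0 -h2 h1.
apply: (aeS (aeI H ae_rat_itv)) => x [Hx [k gk kx]].
exists (v k.+1 x); apply: cvg_near_cst.
by exists k.+1 => // m /= km; apply: (Hx _ _ k).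
Qed.

Let N n := ip (v n) (v n).

(** By Pythagoras the squared norms increase, and by Bessel they are bounded by that of [f]; hence
    [v] is Cauchy. *)
Let N_diff n m : (n <= m)%N -> ip (v m - v n) (v m - v n) = N m - N n.
Proof.
move=> nm; have := pythagoras ipP (v_orth nm (vF n)).
by rewrite subrK /N => ->; rewrite addrK.
Qed.

Let N_ub : has_ubound (range N).
Proof. by exists (ip f f) => _ [n _ <-]; exact: (bessel ipP (finF n)). Qed.

Let N_sup e : 0 < e -> exists n0, forall n, (n0 <= n)%N -> sup (range N) - N n < e.
Proof.
move=> e0; have hs : has_sup (range N) by split; first by exists (N 0), 0%N.
have [_ [n0 _ <-] Nn0] := sup_adherent e0 hs.
exists n0 => n n0n; have := N_diff n0n.
have := ip_ge0 ipP (v n - v n0).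
by lra.
Qed.

(* On each rational interval contained in J the projections onto the spans of the finite
   sets [F n] are eventually constant, so they converge almost everywhere; by Fatou's
   lemma the pointwise limit is also the limit in L2. *)
Lemma clspan_proj : exists2 w, clspan Phi w & forall phi, Phi phi -> ip (f - w) phi = 0.
Proof.
(* The upper limit is defined and measurable everywhere, and equals the limit wherever the latter
   exists. *)
pose w0 (x : T) : R := fine (limn_esup (fun m => (v m x)%:E)).
have mw0 : measurable_fun setT w0.
  have mlim : measurable_fun setT (fun x : T => limn_esup (fun m => (v m x)%:E)).
    by apply: measurable_fun_limn_esup => n; apply/measurable_EFinP; exact: measurable_L2.
  exact: (measurableT_comp (fine_measurable measurableT) mlim).
have vw0 : \forall x \ae mu, (fun m => v m x) @ \oo --> w0 x.
  by apply: (aeS v_cvg) => x [l vl]; rewrite /w0 (limn_esup_fine vl).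
have fatou_v n : (\int[mu]_x ((w0 x - v n x) ^+ 2)%:E <= (sup (range N) - N n)%:E)%E.
  apply: (@L2_fatou (fun m => v (m + n)%N)) => //.
    by apply: (aeS vw0) => x vx; rewrite (cvg_shiftn n (fun m => v m x)).
  move=> m; rewrite N_diff ?leq_addl// lerD2r; apply: ub_le_sup => //.
have w0L : w0 \in Lfun mu 2%:E.
  have H : (fun x => w0 x - v 0%N x) \in Lfun mu 2%:E.
    apply: Lfun2P; last exact: le_lt_trans (fatou_v 0%N) (ltry _).
    exact: (measurable_funB mw0 (measurable_L2 (v 0%N))).
  have := Lfun2_lin 1 H (L2_Lfun (v 0%N)).
  suff <- : w0 = (fun x => 1 * (w0 x - v 0%N x) + v 0%N x) by [].
  by apply/funext => x; rewrite mul1r subrK.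
have [w ww0] := L2_exists w0L.
have wv e : 0 < e -> exists n0, forall n, (n0 <= n)%N -> ip (w - v n) (w - v n) < e.
  move=> /N_sup[n0 Hn0]; exists n0 => n /Hn0; apply: le_lt_trans.
  rewrite -lee_fin; apply: le_trans (fatou_v n); rewrite -L2_inner_sqr le_eqVlt.
  apply/orP; left; apply/eqP; apply: ae_eq_integral => //.
  - by apply/measurable_EFinP/measurable_funX; exact: measurable_L2.
  - by apply/measurable_EFinP/measurable_funX/measurable_funB => //; exact: measurable_L2.
  - by apply: (aeS (aeI ww0 (L2_BE w (v n)))) => x [/(_ I) <- ->] _.
exists w.
  rewrite clspanE => e /wv[n0 /(_ _ (leqnn _)) ?]; exists (v n0) => //.
  by move: (vF n0); apply: linspanS => phi [].
move=> phi Pphi.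
have [[n0 Fphi]|nF] := pselect (exists n, F n phi); last first.
  (* A member of [Phi] outside every [F n] vanishes on all rational intervals inside [J]. *)
  suff -> : phi = 0 by rewrite (ip0r ipP).
  apply: vanishes_setT.
  have H : \forall x \ae mu, forall k, good k -> rat_itv k x -> phi x = 0.
    apply: ae_foralln => k; have [gk|] := pselect (good k); last first.
      by move=> h; apply: aeW => x /h.
    suff h : vanishes_on (rat_itv k) phi by apply: (aeS h) => x /= hx _ /hx.
    by apply: contrapT => nv; apply: nF; exists k.+1; split => //; exists k.
  by apply: (aeS (aeI H ae_rat_itv)) => x [Hx [k gk kx]] _; apply: Hx gk kx.
apply/eqP/negPn/negP => fw0.
have phi0 : ip phi phi != 0.
  by apply: contra_neq fw0 => /(ip_eq0 ipP) ->; rewrite (ip0r ipP).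
have phip : 0 < ip phi phi by rewrite lt0r phi0 (ip_ge0 ipP).
have [|n1 Hn1] := wv (ip (f - w) phi ^+ 2 / ip phi phi).
  by rewrite divr_gt0// exprn_even_gt0.
pose n := maxn n0 n1.
have := Hn1 n (leq_maxr _ _); rewrite ltr_pdivlMr// ltNge => /negP; apply.
apply: le_trans (cauchy_schwarz ipP _ _).
have : ip (f - v n) phi = 0.
  by apply: (proj_orth ipP (finF n)); apply/sub_linspan/(FS (leq_maxl _ _)).
rewrite !(ipBl ipP) => /eqP; rewrite subr_eq0 => /eqP ->.
by rewrite -(opprB (ip w phi)) sqrrN.
Qed.

End projection.

End vanishing.

(** * Knots *)

Section knots.
Context {R : realType} {J : interval R} {a : set R}.
Hypothesis ha : knot_sequence J a.
Implicit Types (x y z : \bar R).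

Let aJ r : a r -> r \in J. Proof. by case: ha => aJ _ _ _ _; exact: aJ. Qed.

Let no_limit r : r \in J -> ~ limit_point a r.
Proof.
by case: ha => _ _ nl _ _ rJ la; have : ([set` J] `&` limit_point a) r by []; rewrite nl.
Qed.

Definition knot x := if x is r%:E then a r else False.
(* Extended by the identity to the infinite ends, which are not knots. *)
Definition enext x := if x is r%:E then knot_succ a r else x.
Definition eprev x := if x is r%:E then knot_pred a r else x.

(** The infimum of the later knots lies in [J], being between two knots; were it not a knot, it
    would be a limit point of [a] in [J]. So it is attained, unless [r] is the last knot. *)
Let next_spec r : a r ->
  (exists t, [/\ a t, knot_succ a r = t%:E, r < t & forall u, a u -> r < u -> t <= u]) \/
  (knot_succ a r = +oo%E /\ forall u, a u -> u <= r).
Proof.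
move=> ar; pose S := [set b | a b /\ r < b].
have [[b Sb]|nS] := pselect (S !=set0); last first.
  right; split; last first.
    by move=> u au; rewrite leNgt; apply/negP => ru; apply: nS; exists u.
  rewrite /knot_succ (_ : [set b | _] = set0) ?image_set0 ?ereal_inf0//.
  by rewrite -subset0 => u Su; apply: nS; exists u.
left; have hS : has_inf S.
  by split; [exists b|exists r => u [_ /ltW]].
pose t := inf S.
have rt : r <= t by apply: lb_le_inf; [exists b|move=> u [_ /ltW]].
have tb : t <= b by apply: ge_inf => //; exact: hS.2.
have tJ : t \in J.
  by apply: (interval_is_interval (aJ ar) (aJ Sb.1)); rewrite rt.
have St : S t.
  apply: contrapT => nSt; apply: (no_limit tJ) => U /nbhs_ballP[e /= e0 eU].
  have [u Su ut] := inf_adherent e0 hS.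
  exists u; split; [|exact: Su.1|].
    by apply/eqP => utE; apply: nSt; rewrite -utE.
  have tu := ge_inf hS.2 Su; rewrite -/t in ut tu.
  by apply: eU; rewrite /ball /= ltr_distl; lra.
exists t; split; [exact: St.1| |exact: St.2|].
  apply/eqP; rewrite eq_le; apply/andP; split.
    by apply: ereal_inf_lbound; exists t.
  apply: le_ereal_inf_tmp => _ [u Su <-]; rewrite lee_fin.
  exact: (ge_inf hS.2 Su).
by move=> u au ru; apply: (ge_inf hS.2).
Qed.

Let prev_spec r : a r ->
  (exists t, [/\ a t, knot_pred a r = t%:E, t < r & forall u, a u -> u < r -> u <= t]) \/
  (knot_pred a r = -oo%E /\ forall u, a u -> r <= u).
Proof.
move=> ar; pose S := [set b | a b /\ b < r].
have [[b Sb]|nS] := pselect (S !=set0); last first.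
  right; split; last first.
    by move=> u au; rewrite leNgt; apply/negP => ru; apply: nS; exists u.
  rewrite /knot_pred (_ : [set b | _] = set0) ?image_set0 ?ereal_sup0//.
  by rewrite -subset0 => u Su; apply: nS; exists u.
left; have hS : has_sup S.
  by split; [exists b|exists r => u [_ /ltW]].
pose t := sup S.
have rt : t <= r by apply: ge_sup; [exists b|move=> u [_ /ltW]].
have tb : b <= t by apply: ub_le_sup => //; exact: hS.2.
have tJ : t \in J.
  by apply: (interval_is_interval (aJ Sb.1) (aJ ar)); rewrite rt tb.
have St : S t.
  apply: contrapT => nSt; apply: (no_limit tJ) => U /nbhs_ballP[e /= e0 eU].
  have [u Su ut] := sup_adherent e0 hS.
  exists u; split; [|exact: Su.1|].
    by apply/eqP => utE; apply: nSt; rewrite -utE.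
  have tu := ub_le_sup hS.2 Su; rewrite -/t in ut tu.
  by apply: eU; rewrite /ball /= ltr_distl; lra.
exists t; split; [exact: St.1| |exact: St.2|].
  apply/eqP; rewrite eq_le; apply/andP; split.
    apply: ge_ereal_sup => _ [u Su <-]; rewrite lee_fin.
    exact: (ub_le_sup hS.2 Su).
  by apply: ereal_sup_ubound; exists t.
by move=> u au ru; apply: (ub_le_sup hS.2).
Qed.

Lemma next_gt x : knot x -> (x < enext x)%E.
Proof.
by case: x => // r /next_spec[[t [_ /= -> rt _]]|[/= -> _]]; rewrite ?lte_fin ?ltry.
Qed.

Lemma prev_lt x : knot x -> (eprev x < x)%E.
Proof.
by case: x => // r /prev_spec[[t [_ /= -> rt _]]|[/= -> _]]; rewrite ?lte_fin ?ltNyr.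
Qed.

Lemma next_knot x : knot x -> knot (enext x) \/ enext x = +oo%E.
Proof. by case: x => // r /next_spec[[t [at_ /= -> _ _]]|[/= -> _]]; [left|right]. Qed.

Lemma prev_knot x : knot x -> knot (eprev x) \/ eprev x = -oo%E.
Proof. by case: x => // r /prev_spec[[t [at_ /= -> _ _]]|[/= -> _]]; [left|right]. Qed.

Lemma next_le x y : knot x -> knot y -> (x < y)%E -> (enext x <= y)%E.
Proof.
case: x y => // r [u| |]//= /next_spec[[t [_ -> _ H]]|[_ H]] au; rewrite lte_fin => ru.
  by rewrite lee_fin; exact: H.
by have := H _ au; rewrite leNgt ru.
Qed.

Lemma prev_ge x y : knot x -> knot y -> (x < y)%E -> (x <= eprev y)%E.
Proof.
case: x y => // r [u| |]//= ar /prev_spec[[t [_ -> _ H]]|[_ H]]; rewrite lte_fin => ru.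
  by rewrite lee_fin; exact: H.
by have := H _ ar; rewrite leNgt ru.
Qed.

Lemma next_prev x : knot x -> knot (eprev x) -> enext (eprev x) = x.
Proof.
move=> Kx Kp; apply/eqP; rewrite eq_le next_le//=; last exact: prev_lt.
rewrite leNgt; apply/negP => nx.
have [Kn|ny] := next_knot Kp; last by move: nx; rewrite ny ltNge leey.
have := prev_ge Kn Kx nx; rewrite leNgt => /negP; apply; exact: next_gt.
Qed.

Lemma prev_next x : knot x -> knot (enext x) -> eprev (enext x) = x.
Proof.
move=> Kx Kn; apply/eqP; rewrite eq_le prev_ge//= ?andbT; last exact: next_gt.
rewrite leNgt; apply/negP => xp.
have [Kp|ny] := prev_knot Kn; last by move: xp; rewrite ny ltNge leNye.
have := next_le Kx Kp xp; rewrite leNgt => /negP; apply; exact: prev_lt.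
Qed.

(** The suprema of [a] and [J] agree. Hence the unbounded interval after the last knot carries no
    mass. *)
Lemma last_knot x : knot x -> enext x = +oo%E -> forall t, t \in J -> (t%:E <= x)%E.
Proof.
case: x => // r ar nr t tJ; case: (ha) => _ _ _ _ supE.
have [[u [_ /= uE _ _]]|[_ H]] := next_spec ar; first by move: nr; rewrite /= uE.
apply: (@le_trans _ _ (ereal_sup (EFin @` [set` J]))).
  by apply: ereal_sup_ubound; exists t.
by rewrite -supE; apply: ge_ereal_sup => _ [u au <-]; rewrite lee_fin H.
Qed.

Lemma first_knot x : knot x -> eprev x = -oo%E -> forall t, t \in J -> (x <= t%:E)%E.
Proof.
case: x => // r ar nr t tJ; case: (ha) => _ _ _ infE _.
have [[u [_ /= uE _ _]]|[_ H]] := prev_spec ar; first by move: nr; rewrite /= uE.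
apply: (@le_trans _ _ (ereal_inf (EFin @` [set` J]))); last first.
  by apply: ereal_inf_lbound; exists t.
by rewrite -infE; apply: le_ereal_inf_tmp => _ [u au <-]; rewrite lee_fin H.
Qed.

End knots.
Arguments knot {R} a x.
Arguments enext {R} a x.
Arguments eprev {R} a x.

(** * Functions carried by a closed interval, up to null sets *)

Section carried.
Context {R : realType} {J : interval R}.
Local Notation mu := (lebesgue_on J).
Implicit Types (f g phi : L2 J) (l r c d : \bar R).

(** By [supp_eitv] this says that the support lies in [eitv l r]; in this form it is evidently
    stable under linear combinations. *)
Definition carried l r f := vanishes_on (~` eitv l r) f.

Lemma ae_neq_ereal c : \forall t \ae mu, t%:E <> c.
Proof.
case: c => [c| |]; last 2 first.
- exact: aeW.
- exact: aeW.
- by apply: (aeS (ae_neq c)) => t tc [].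
Qed.

Lemma carried_submodule l r : submodule (carried l r).
Proof. exact: vanishes_submodule. Qed.

Lemma carriedS l r l' r' f : (l' <= l)%E -> (r <= r')%E ->
  carried l r f -> carried l' r' f.
Proof.
move=> ll rr; apply: vanishesS; apply: subsetC => t /= /andP[lt tr].
by rewrite /eitv /= (le_trans ll)//= (le_trans tr).
Qed.

Lemma carried_meet l r l' r' f : carried l r f -> carried l' r' f -> carried l' r f.
Proof.
move=> c1 c2; apply: (aeS (aeI c1 c2)) => t [/= h1 h2] nt.
have [lrt|] := pselect (eitv l r t); last exact: h1.
apply: h2 => /= /andP[l't _]; apply: nt; move: lrt => /andP[_ tr].
by rewrite /eitv /= l't.
Qed.

(** The intervals share at most the point [r], a null set. *)
Lemma carried_disjoint l r l' r' f g : (r <= l')%E ->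
  carried l r f -> carried l' r' g -> L2_inner f g = 0.
Proof.
move=> rl cf cg; apply: vanishes_inner.
apply: (aeS (aeI (aeI cf cg) (ae_neq_ereal r))) => t [[/= h1 h2] tr].
have [h|h] := pselect (eitv l r t); last by left; exact: h1.
right; apply: h2 => /andP[l't _]; apply: tr.
by apply/eqP; rewrite eq_le (le_trans rl l't) andbT; case/andP: h.
Qed.

Lemma carried_eq0 l r f : (r <= l)%E -> carried l r f -> f = 0.
Proof.
move=> rl cf; apply: (ip_eq0 L2_inner_product).
exact: (carried_disjoint rl cf cf).
Qed.

Lemma carried_vanishes_right l r c d f : (r <= c)%E -> carried l r f ->
  vanishes_on (eitv c d) f.
Proof.
move=> rc cf; apply: (aeS (aeI cf (ae_neq_ereal r))) => t [/= h1 tr] /andP[ct _].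
apply: h1 => /andP[_ rt]; apply: tr; apply/eqP.
by rewrite eq_le rt (le_trans rc).
Qed.

Lemma carried_vanishes_left l r c d f : (d <= l)%E -> carried l r f ->
  vanishes_on (eitv c d) f.
Proof.
move=> dl cf; apply: (aeS (aeI cf (ae_neq_ereal l))) => t [/= h1 tl] /andP[_ td].
apply: h1 => /andP[lt _]; apply: tl; apply/eqP.
by rewrite eq_le lt (le_trans td).
Qed.

Lemma carried_vanishes_eq0 l r f : carried l r f -> vanishes_on (eitv l r) f -> f = 0.
Proof.
move=> c1 v1; apply: vanishes_setT; apply: (aeS (aeI c1 v1)) => t [/= h1 h2] _.
by have [/h2|/h1] := pselect (eitv l r t).
Qed.

(** [linspan] allows repeated vectors while [restr_lin_indep] speaks of injective families, so
    repetitions are merged into one coefficient each. *)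
Lemma restr_lin_indep_span I (S : set (L2 J)) w : restr_lin_indep I S ->
  linspan S w -> vanishes_on I w -> w = 0.
Proof.
move=> iS [n [phi [c [Sphi ->]]]] vw.
pose t := undup [seq phi i | i <- enum 'I_n].
have St f : f \in t -> S f by rewrite mem_undup => /mapP[i _ ->].
have : linspan [set` t] (\sum_(i < n) c i *: phi i).
  exists n, phi, c; split => // i /=; rewrite mem_undup; apply: map_f.
  by rewrite mem_enum.
move/(linspan_seq (undup_uniq _)) => [d wE].
have wE' : \sum_(i < n) c i *: phi i =
    \sum_(i < size t) d (tnth (in_tuple t) i) *: tnth (in_tuple t) i.
  by rewrite wE -(big_tnth _ _ _ xpredT (fun v => d v *: v)).
rewrite wE'; apply: big1 => i _.
suff -> : d (tnth (in_tuple t) i) = 0 by rewrite scale0r.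
apply: (iS _ (tnth (in_tuple t)) (fun i => d (tnth (in_tuple t) i))).
- by apply/tuple_uniqP; exact: undup_uniq.
- by move=> j; apply: St; rewrite mem_tnth.
- rewrite wE' in vw.
  have H := lincombE (fun i => d (tnth (in_tuple t) i)) (tnth (in_tuple t)).
  by apply: (aeS (aeI vw H)) => x [/= h1 <-].
Qed.

(** Once the combination is zero, its inner product with [phi i] isolates [c i]. *)
Lemma span_restr_lin_indep I (S : set (L2 J)) : orthsys (@L2_inner R J) S ->
  (forall w, linspan S w -> vanishes_on I w -> w = 0) -> restr_lin_indep I S.
Proof.
move=> [S0 oS] H n phi c iphi Sphi vw i.
have w0 : \sum_(i < n) c i *: phi i = 0.
  apply: H; first by exists n, phi, c.
  by apply: (aeS (aeI vw (lincombE c phi))) => x [/= h1 ->].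
have := ip0l L2_inner_product (phi i); rewrite -w0.
rewrite (bigD1 i)//= (ipDl L2_inner_product) (ipZl L2_inner_product).
have -> : L2_inner (\sum_(j < n | j != i) c j *: phi j) (phi i) = 0.
  elim/big_ind : _ => [|u v u0 v0|j ji].
  - exact: (ip0l L2_inner_product).
  - by rewrite (ipDl L2_inner_product) u0 v0 addr0.
  - rewrite (ipZl L2_inner_product) oS ?mulr0// => /iphi ij.
    by rewrite ij eqxx in ji.
rewrite addr0 => /eqP; rewrite mulf_eq0 => /orP[/eqP//|/eqP /(ip_eq0 L2_inner_product) phi0].
by exfalso; apply: S0; rewrite -phi0.
Qed.

End carried.

Lemma neq_ltP {R : realType} (x y : \bar R) : x <> y -> (x < y)%E \/ (y < x)%E.
Proof. by move=> /eqP; rewrite neq_lt => /orP. Qed.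

(** * Short and long basis functions *)

Section short_long.
Context {R : realType} {J : interval R} {a : set R}.
Hypothesis ha : knot_sequence J a.
Local Notation ip := (@L2_inner R J).
Local Notation ipP := (@L2_inner_product R J).
Local Notation K := (knot a).
Local Notation s := (enext a).
Local Notation p := (eprev a).
Implicit Types (f g phi : L2 J) (x y l : \bar R) (Phi : set (L2 J)).

(* [shortb] and [longb] are [breve] and [bar], emptied at non-knots. *)
Definition shortb Phi x : set (L2 J) := [set f | [/\ K x, Phi f & carried x (s x) f]].

Definition longb Phi x : set (L2 J) := [set f | [/\ K x, Phi f, carried (p x) (s x) f,
  ~ (K (p x) /\ carried (p x) x f) & ~ carried x (s x) f]].

Lemma carried_last x f : K x -> s x = +oo%E -> carried -oo x f.
Proof.
move=> Kx sx; apply: (aeS ae_mem) => t tJ nt; exfalso; apply: nt.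
by rewrite /eitv /= leNye (last_knot ha Kx sx).
Qed.

Lemma carried_first x f : K x -> p x = -oo%E -> carried x +oo f.
Proof.
move=> Kx px; apply: (aeS ae_mem) => t tJ nt; exfalso; apply: nt.
by rewrite /eitv /= leey andbT (first_knot ha Kx px).
Qed.

(** At the first knot [J] has nothing to the left, so a function carried by [eitv (p x) (s x)] is
    already carried by the right half; symmetrically at the last knot. *)
Lemma longb_knots Phi x f : longb Phi x f -> [/\ K (p x), K (s x) & ~ carried (p x) x f].
Proof.
move=> [Kx Pf cf nl nr].
have Kp : K (p x).
  have [//|px] := prev_knot ha Kx; exfalso; apply: nr.
  exact: carried_meet cf (carried_first f Kx px).
have nc : ~ carried (p x) x f by move=> c; apply: nl.
split => //; have [//|sx] := next_knot ha Kx; exfalso; apply: nc.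
apply: carried_meet (carried_last f Kx sx) cf.
Qed.

Lemma breveE Phi x : K x \/ (x = -oo \/ x = +oo)%E -> breve a Phi x = shortb Phi x.
Proof.
case: x => [r| |] Kx /=.
- have {}Kx : a r by case: Kx => // -[].
  by apply/seteqP; split=> f [] => [Pf /supp_eitv|? Pf /supp_eitv].
- by apply/esym; rewrite -subset0 => f [].
- by apply/esym; rewrite -subset0 => f [].
Qed.

Section nonzero.
Variable Phi : set (L2 J).
Hypothesis Phi0 : ~ Phi 0.

(** The functions of the previous interval are removed by definition; a short function at [r] is not
    among them, as it would be carried by a single point and thus be zero. *)
Lemma at_knotE r : a r -> at_knot a Phi r = shortb Phi r%:E `|` longb Phi r%:E.
Proof.
move=> ar; have Kr : K r%:E by [].
have prE : knot_pred a r = p r%:E by [].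
have bE : breve a Phi (knot_pred a r) = shortb Phi (p r%:E).
  by apply: breveE; have [|] := prev_knot ha Kr; [left|right; left].
apply/seteqP; split=> f.
  rewrite /at_knot bE => -[[Pf /supp_eitv cf] nb].
  have [cs|ncs] := pselect (carried r%:E (s r%:E) f); [by left|right; split => //].
  by move=> [Kp cp]; apply: nb; split => //; rewrite (next_prev ha).
rewrite /at_knot bE => -[[_ Pf cf]|[_ Pf cf nl nr]].
  split.
    split => //; apply/supp_eitv; apply: carriedS cf => //.
    by rewrite prE ltW// (prev_lt ha).
  move=> [Kp _]; rewrite (next_prev ha)// => cp; apply: Phi0.
  by rewrite -(carried_eq0 (lexx _) (carried_meet cp cf)).
split; first by split => //; apply/supp_eitv.
by move=> [Kp _]; rewrite (next_prev ha)// => cp; apply: nl.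
Qed.

Lemma barE x : K x \/ x = +oo%E -> bar a Phi x = longb Phi x.
Proof.
case: x => [r| |] Kx; last 2 first.
- by apply/esym; rewrite -subset0 => f [].
- by apply/esym; rewrite -subset0 => f [].
have ar : a r by case: Kx.
rewrite /bar at_knotE// (breveE Phi (x := r%:E)); last by left.
apply/seteqP; split=> f; first by move=> [[//|]].
by move=> Lf; split; [right|move=> [_ _ cf]; case: Lf].
Qed.

End nonzero.

Section overlap.
Variable Phi : set (L2 J).
Hypothesis Phi0 : ~ Phi 0.
Hypothesis oPhi : forall f g, Phi f -> Phi g -> f <> g -> ip f g = 0.

Lemma short_orth x y : x <> y -> orth ip (shortb Phi x) (shortb Phi y).
Proof.
move=> xy f g [Kx Pf cf] [Ky Pg cg]; have [xy'|yx] := neq_ltP xy.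
  exact: carried_disjoint (next_le ha Kx Ky xy') cf cg.
by rewrite (ipC ipP); exact: carried_disjoint (next_le ha Ky Kx yx) cg cf.
Qed.

(** For [x < y] the function would be carried by the left half of its long interval, for [y < x] by
    at most one point. *)
Lemma short_long x y f : shortb Phi x f -> longb Phi y f -> False.
Proof.
move=> [Kx Pf cf] L; have [Kp Ks ncp] := longb_knots L; case: L => [Ky _ cf' _ ncs].
have [xyE|xy] := pselect (x = y); first by apply: ncs; rewrite -xyE.
have [xy'|yx] := neq_ltP xy.
  by apply: ncp; apply: carriedS (carried_meet cf cf') => //; exact: (next_le ha).
apply: Phi0; rewrite -(carried_eq0 _ (carried_meet cf' cf)) //.
exact: (next_le ha).
Qed.

Lemma short_long_orth x y : orth ip (shortb Phi x) (longb Phi y).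
Proof.
move=> f g Af Bg; apply: oPhi; [by case: Af|by case: Bg|].
by move=> fg; rewrite fg in Af; exact: short_long Af Bg.
Qed.

(** The two long intervals meet inside [eitv x (s x)], which would make [f] short at [x]. *)
Lemma long_inj x y f : longb Phi x f -> longb Phi y f -> (x < y)%E -> False.
Proof.
move=> Lx Ly xy; case: Lx => [Kx Pf cx _ ncx]; case: Ly => [Ky _ cy _ _].
by apply: ncx; apply: carriedS (carried_meet cx cy) => //; exact: (prev_ge ha).
Qed.

Lemma long_orth x y : x <> y -> orth ip (longb Phi x) (longb Phi y).
Proof.
move=> xy f g Bf Bg; apply: oPhi; [by case: Bf|by case: Bg|].
move=> fg; rewrite fg in Bf; have [xy'|yx] := neq_ltP xy.
  exact: long_inj Bf Bg xy'.
exact: long_inj Bg Bf yx.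
Qed.

End overlap.
End short_long.

Arguments shortb {R J} a Phi x _.
Arguments longb {R J} a Phi x _.

(** * Elements of the closed span that are carried between knots *)

Section basis.
Context {R : realType} {J : interval R} {a : set R}.
Hypothesis ha : knot_sequence J a.
Local Notation ip := (@L2_inner R J).
Local Notation ipP := (@L2_inner_product R J).
Local Notation K := (knot a).
Local Notation s := (enext a).
Local Notation p := (eprev a).
Implicit Types (f g phi : L2 J) (x y l : \bar R).

Variable Phi : set (L2 J).
Hypothesis hPhi : orthogonal_centered_basis a Phi.
Local Notation A := (shortb a Phi).
Local Notation B := (longb a Phi).

Lemma basis_orth f g : Phi f -> Phi g -> f <> g -> ip f g = 0.
Proof. by case: hPhi => _; exact. Qed.

(** Independence rules out the family consisting of [0] alone. *)
Lemma basis_neq0 : ~ Phi 0.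
Proof.
case: hPhi => [[_ PhiE indep] _] P0.
have [r ar a0] : (\bigcup_(r in a) at_knot a Phi r) 0 by rewrite -PhiE.
have c0 l x : carried l x (0 : L2 J) by exact: (carried_submodule l x).1.
have : (1 : R) = 0; last by apply/eqP; exact: oner_neq0.
have := @indep r ar 1 (fun=> 0) (fun=> 1); apply => //.
- by move=> i j _; rewrite !ord1.
- by left.
- apply: (aeS L2_0E) => x x0 _.
  by rewrite /lincomb big_ord1 x0 mulr0.
- exact: ord0.
Qed.

Lemma basis_at_knot r : a r -> at_knot a Phi r = A r%:E `|` B r%:E.
Proof. exact: (at_knotE ha basis_neq0). Qed.

Lemma basis_cover f : Phi f -> exists x, A x f \/ B x f.
Proof.
case: hPhi => [[_ PhiE _] _] Pf.
have [r ar] : (\bigcup_(r in a) at_knot a Phi r) f by rewrite -PhiE.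
by rewrite basis_at_knot//; exists r%:E.
Qed.

Lemma basis_indep x w : K x -> linspan (A x `|` B x `|` B (s x)) w ->
  vanishes_on (eitv x (s x)) w -> w = 0.
Proof.
case: x => // r ar; case: hPhi => [[_ _ /(_ _ ar)]] + _.
rewrite basis_at_knot//.
have -> : bar a Phi (knot_succ a r) = B (s r%:E).
  by apply: (barE ha basis_neq0); exact: (next_knot ha (x := r%:E)).
by move=> H; exact: restr_lin_indep_span.
Qed.

Lemma finite_carried l r : K l -> K r ->
  finite_set [set phi | Phi phi /\ carried l r phi].
Proof.
case: l r => // l [r| |]// al ar.
have aJ t : a t -> t \in J by case: ha => aJ _ _ _ _; exact: aJ.
case: hPhi => [[lf _ _] _].
have sJ : `[l, r] `<=` [set` J].
  move=> t /= tlr; apply: (interval_is_interval (aJ _ al) (aJ _ ar)).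
  by move: tlr; rewrite in_itv.
apply: sub_finite_set (lf l r sJ) => phi [Pphi cphi].
split => // v; apply: basis_neq0.
suff <- : phi = 0 by [].
apply: (carried_vanishes_eq0 cphi); apply: vanishesS v => t.
by rewrite /eitv /= !lee_fin in_itv.
Qed.

(** After the last knot the interval is unbounded, but only [0] is carried by it. *)
Lemma finite_short x : finite_set (A x).
Proof.
have [Kx|nKx] := pselect (K x); last first.
  by apply: (@sub_finite_set _ _ set0) => // f [].
have [Ks|sx] := next_knot ha Kx.
  by apply: sub_finite_set (finite_carried Kx Ks) => f [].
apply: (@sub_finite_set _ _ set0) => // f [_ Pf cf]; apply: basis_neq0.
by rewrite -(carried_eq0 (lexx _) (carried_meet (carried_last ha f Kx sx) cf)).
Qed.

Lemma finite_long x : finite_set (B x).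
Proof.
have [[Kp Ks]|nK] := pselect (K (p x) /\ K (s x)); last first.
  by apply: (@sub_finite_set _ _ set0) => // f /(longb_knots ha)[Kp Ks _]; apply: nK.
by apply: sub_finite_set (finite_carried Kp Ks) => f [_ Pf cf _ _]; split.
Qed.

(* Besides the basis functions supported in [l, r], only those in [longb l] and [longb r]
   can be non-orthogonal to [f]; their components vanish by independence on the
   intervals adjacent to [l, r], where all the other terms vanish. *)
Lemma clspan_carried l r f : (K l \/ l = -oo%E) -> (K r \/ r = +oo%E) -> (l < r)%E ->
  finite_set [set phi | Phi phi /\ carried l r phi] ->
  clspan Phi f -> carried l r f ->
  linspan [set phi | Phi phi /\ carried l r phi] f.
Proof.
move=> Kl Kr lr finG; rewrite clspanE => cf fc.
set G := [set phi | _] in finG *.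
have next_l y : K y -> (y < l)%E -> (s y <= l)%E.
  by case: Kl => [Kl|->] Ky; [exact: (next_le ha)|rewrite ltNge leNye].
have next_r y : K y -> (y < r)%E -> (s y <= r)%E.
  by case: Kr => [Kr|->] Ky; [exact: (next_le ha)|rewrite leey].
have prev_l y : K y -> (l < y)%E -> (l <= p y)%E.
  by case: Kl => [Kl|->] Ky; [exact: (prev_ge ha)|rewrite leNye].
have prev_r y : K y -> (r < y)%E -> (r <= p y)%E.
  by case: Kr => [Kr|->] Ky; [exact: (prev_ge ha)|rewrite ltNge leey].
have : linspan (G `|` B l `|` B r) f.
  apply: (clos_finite ipP (S := Phi)) => //.
  - by rewrite !finite_setU; split; [split|]; rewrite //; exact: finite_long.
  - by move=> phi [[[]|[]]|[]].
  - exact: basis_orth.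
  - move=> phi Pphi nF; have [y [[Ky _ cy]|By]] := basis_cover Pphi.
      have [yl|ly] := ltP y l.
        by rewrite (ipC ipP); exact: carried_disjoint (next_l _ Ky yl) cy fc.
      have [yr|ry] := ltP y r; last exact: carried_disjoint ry fc cy.
      exfalso; apply: nF; left; left; split => //.
      exact: carriedS (next_r _ Ky yr) cy.
    have [Ky _ cy _ _] := By.
    have [yl|/neq_ltP[yl|ly]] := pselect (y = l).
    - by exfalso; apply: nF; left; right; rewrite -yl.
    - by rewrite (ipC ipP); exact: carried_disjoint (next_l _ Ky yl) cy fc.
    have [yr|/neq_ltP[yr|ry]] := pselect (y = r).
    - by exfalso; apply: nF; right; rewrite -yr.
    - exfalso; apply: nF; left; left; split => //.
      exact: carriedS (prev_l _ Ky ly) (next_r _ Ky yr) cy.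
    - exact: carried_disjoint (prev_r _ Ky ry) fc cy.
move=> /linspanU[_ [c [/linspanU[g [b [Gg Bb ->]]] Bc fE]]].
have B0 x u : linspan (B x) u -> (forall v, ~ B x v) -> u = 0.
  by move=> Bu nB; apply: linspan_set0; apply: linspanS Bu => v /nB.
have Gvan x y u : (r <= x)%E \/ (y <= l)%E -> linspan G u -> vanishes_on (eitv x y) u.
  move=> h; apply: linspan_sub; first exact: vanishes_submodule.
  move=> v [_ cv]; case: h => h.
    exact: carried_vanishes_right h cv.
  exact: carried_vanishes_left h cv.
have b0 : b = 0.
  have [[Kpl Kl']|nK] := pselect (K (p l) /\ K l); last first.
    by apply: B0 Bb _ => v Bv; apply: nK; split; [case: (longb_knots ha Bv)|case: Bv].
  apply: (basis_indep Kpl); rewrite (next_prev ha)//.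
    by apply: linspanS Bb => v; right.
  have -> : b = f - c - g by rewrite fE addrK addrC addKr.
  apply: submoduleB; [exact: vanishes_submodule| |by apply: Gvan Gg; right].
  apply: submoduleB; [exact: vanishes_submodule|exact: carried_vanishes_left fc|].
  move: Bc; apply: linspan_sub; first exact: vanishes_submodule.
  move=> v [Kr' _ cv _ _]; apply: carried_vanishes_left cv.
  exact: prev_l.
have c0 : c = 0.
  have [Kr'|nK] := pselect (K r); last by apply: B0 Bc _ => v [].
  apply: (basis_indep Kr'); first by apply: linspanS Bc => v; left; right.
  have -> : c = f - (g + b) by rewrite fE addrC addKr.
  apply: submoduleB; [exact: vanishes_submodule|exact: carried_vanishes_right fc|].
  apply: submoduleD; [exact: vanishes_submodule|by apply: Gvan Gg; left|].
  move: Bb; apply: linspan_sub; first exact: vanishes_submodule.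
  move=> v [Kl' _ cv _ _]; apply: carried_vanishes_right cv.
  exact: next_r.
by rewrite fE b0 c0 !addr0.
Qed.

(** At the last knot [s x] is [+oo], which is why [clspan_carried] admits that right end. *)
Lemma clspan_short x f : K x -> clspan Phi f -> carried x (s x) f -> linspan (A x) f.
Proof.
move=> Kx Vf cf.
have AE : A x = [set phi | Phi phi /\ carried x (s x) phi].
  by apply/seteqP; split=> phi []; split.
rewrite AE; apply: clspan_carried => //.
- by left.
- exact: (next_knot ha).
- exact: (next_gt ha).
- by rewrite -AE; exact: finite_short.
Qed.

Lemma clspan_long x f : K x -> K (p x) -> K (s x) -> clspan Phi f ->
  carried (p x) (s x) f -> linspan (A (p x) `|` B x `|` A x) f.
Proof.
move=> Kx Kp Ks Vf cf.
have : linspan [set phi | Phi phi /\ carried (p x) (s x) phi] f.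
  apply: clspan_carried => //; [by left|by left| |exact: finite_carried].
  exact: lt_trans (prev_lt ha Kx) (next_gt ha Kx).
apply: linspanS => phi [Pphi cphi].
have [cx|ncx] := pselect (carried x (s x) phi); first by right; split.
have [cp|ncp] := pselect (carried (p x) x phi).
  by left; left; split; rewrite ?(next_prev ha).
by left; right; split => // -[].
Qed.

End basis.

(** * The orthogonal complement *)

Section complement.
Context {R : realType} {J : interval R} {a : set R}.
Hypothesis ha : knot_sequence J a.
Local Notation ip := (@L2_inner R J).
Local Notation ipP := (@L2_inner_product R J).
Local Notation K := (knot a).
Local Notation s := (enext a).
Local Notation p := (eprev a).
Implicit Types (f g phi psi : L2 J) (x y l : \bar R).

Variables Phi0 Phi1 : set (L2 J).
Hypothesis hPhi0 : orthogonal_centered_basis a Phi0.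
Hypothesis hPhi1 : orthogonal_centered_basis a Phi1.
Hypothesis hV : clspan Phi0 `<=` clspan Phi1.
Local Notation A0 := (shortb a Phi0).
Local Notation B0 := (longb a Phi0).
Local Notation A1 := (shortb a Phi1).
Local Notation B1 := (longb a Phi1).

Let N x : set (L2 J) := vanishes_on (eitv x (s x)).

Lemma sub_clspan (Phi : set (L2 J)) : Phi `<=` clspan Phi.
Proof. by rewrite clspanE => f Pf; apply/(sub_clos ipP)/sub_linspan. Qed.

Lemma complement_exists : exists AW BW, two_scale_complement ip K s p A0 B0 A1 B1 N AW BW.
Proof.
apply: (two_scale_split ipP).
- exact: (next_prev ha).
- exact: (prev_next ha).
- by move=> x Kx px; have := prev_lt ha Kx; rewrite px ltxx.
- move=> x Kx sp; have := lt_trans (prev_lt ha Kx) (next_gt ha Kx).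
  by rewrite sp ltxx.
- by move=> x Kx sx; have := next_gt ha Kx; rewrite sx ltxx.
- by move=> x u [].
- by move=> x u [].
- exact: (finite_short ha hPhi0).
- exact: (finite_long ha hPhi0).
- exact: (finite_short ha hPhi1).
- exact: (finite_long ha hPhi1).
- exact: (long_orth ha (basis_orth hPhi0)).
- exact: (short_long_orth ha (basis_neq0 hPhi0) (basis_orth hPhi0)).
- exact: (short_orth ha).
- exact: (long_orth ha (basis_orth hPhi1)).
- exact: (short_long_orth ha (basis_neq0 hPhi1) (basis_orth hPhi1)).
- move=> x f [Kx Pf cf]; apply: (clspan_short ha hPhi1) => //.
  exact/hV/sub_clspan.
- move=> x f Bf; have [Kp Ks _] := longb_knots ha Bf; have [Kx Pf cf _ _] := Bf.
  apply: (clspan_long ha hPhi1) => //.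
  exact/hV/sub_clspan.
- by move=> x; exact: vanishes_submodule.
- move=> x Kx f [Kp Pf]; rewrite (next_prev ha)// => cf.
  exact: carried_vanishes_right (lexx _) cf.
- by move=> x Kx f [Ks Pf cf]; exact: carried_vanishes_left (lexx _) cf.
- by move=> x w Kx Aw Nw; exact: (basis_indep ha hPhi1 Kx).
Qed.

(** * The functions of [AW] and [BW] form a centered basis *)

Section psi.
Variables AW BW : \bar R -> set (L2 J).
Hypothesis tsc : two_scale_complement ip K s p A0 B0 A1 B1 N AW BW.

Definition Psi_of : set (L2 J) := [set f | exists x, AW x f \/ BW x f].
Local Notation Psi := Psi_of.

Lemma AW_knot x f : AW x f -> K x.
Proof.
move=> Af; apply: contrapT => nK; have [W0 _] := tsAW_orthsys tsc x; apply: W0.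
suff <- : f = 0 by [].
by apply: linspan_set0; apply: linspanS (tsAW_sub tsc Af) => g [].
Qed.

Lemma BW_knot x f : BW x f -> [/\ K x, K (p x) & K (s x)].
Proof.
move=> /(tsBW_long tsc)[b [Bb|Bb]]; have [? ? _] := longb_knots ha Bb.
  by case: Bb.
by case: Bb.
Qed.

Lemma AW_carried x f : AW x f -> carried x (s x) f.
Proof.
move=> /(tsAW_sub tsc); apply: linspan_sub; first exact: carried_submodule.
by move=> g [].
Qed.

Lemma BW_carried x f : BW x f -> carried (p x) (s x) f.
Proof.
move=> Bf; have [Kx Kp Ks] := BW_knot Bf.
move: Bf => /(tsBW_sub tsc); apply: linspan_sub; first exact: carried_submodule.
move=> g [[[_ _ cg]|[_ _ cg _ _]]|[_ _ cg]] //.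
  rewrite (next_prev ha) in cg => //.
  by apply: carriedS cg => //; exact/ltW/(next_gt ha).
by apply: carriedS cg => //; exact/ltW/(prev_lt ha).
Qed.

Lemma Psi_span1 : Psi `<=` linspan Phi1.
Proof.
move=> f [x [/(tsAW_sub tsc)|/(tsBW_sub tsc)]].
  by apply: linspanS => g [].
by apply: linspanS => g [[[]|[]]|[]].
Qed.

Lemma Psi_neq0 : ~ Psi 0.
Proof.
by move=> [x [Z|Z]]; [case: (tsAW_orthsys tsc x)|case: (tsBW_orthsys tsc x)].
Qed.

Lemma Psi_orth f g : Psi f -> Psi g -> f <> g -> ip f g = 0.
Proof.
move=> [x [Wf|Wf]] [y [Wg|Wg]] fg.
- have [xy|xy] := pselect (x = y); last exact: (tsAW_orth tsc xy).
  by subst y; have [_ oA] := tsAW_orthsys tsc x; exact: oA.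
- exact: (tsAW_BW tsc Wf Wg).
- by rewrite (ipC ipP); exact: (tsAW_BW tsc Wg Wf).
- have [xy|xy] := pselect (x = y); last exact: (tsBW_orth tsc xy).
  by subst y; have [_ oB] := tsBW_orthsys tsc x; exact: oB.
Qed.

Lemma Psi_orth0 : orth ip Psi Phi0.
Proof.
move=> f g [x Wf] /(basis_cover ha hPhi0)[y Pg]; rewrite (ipC ipP).
case: Wf => Wf; case: Pg => Pg.
- exact: (tsA0_AW tsc Pg Wf).
- exact: (tsB0_AW tsc Pg Wf).
- exact: (tsA0_BW tsc Pg Wf).
- exact: (tsB0_BW tsc Pg Wf).
Qed.

Lemma Psi_gen : Phi1 `<=` linspan (Phi0 `|` Psi).
Proof.
move=> f /(basis_cover ha hPhi1)[x Pf].
apply: (ts_gen tsc _ _ _ _ (x := x)) => //.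
- by move=> y g [_ Pg _]; left.
- by move=> y g [_ Pg _ _ _]; left.
- by move=> y g Wg; right; exists y; left.
- by move=> y g Wg; right; exists y; right.
Qed.

(** Supports alone decide which functions of [Psi] count as short, so [AW] and [BW] are recovered
    from [Psi] only thanks to this. If [f] were short, [clspan_short] would put it in the span of
    [A1 y] and [tsAW_max] in that of [AW y], which is orthogonal to [f]. *)
Lemma BW_not_short x y f : BW x f -> K y -> ~ carried y (s y) f.
Proof.
move=> Bf Ky cf.
have Pf : Psi f by exists x; right.
have f0 : f <> 0 by move=> fz; apply: Psi_neq0; rewrite -fz.
have o0 : orth ip [set f] Phi0 by move=> _ g ->; exact: Psi_orth0.
apply: f0; apply: (ip_eq0 ipP).
apply: (orth_spanl ipP (tsAW_BW tsc (x := y) (y := x))) Bf.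
apply: (tsAW_max tsc Ky).
- apply: (clspan_short ha hPhi1 Ky _ cf); rewrite clspanE.
  exact/(sub_clos ipP)/Psi_span1.
- by move=> u v uf [_ Pv _]; exact: o0.
- by move=> u v uf [_ Pv _ _ _]; exact: o0.
- by move=> u v uf [_ Pv _ _ _]; exact: o0.
Qed.

Lemma short_Psi x : shortb a Psi x = AW x.
Proof.
apply/seteqP; split=> f; last first.
  by move=> Af; split; [exact: AW_knot Af|exists x; left|exact: AW_carried].
move=> [Kx Pf cf].
have f0 : f <> 0 by move=> fz; apply: Psi_neq0; rewrite -fz.
case: Pf => y [Wf|Wf]; last by exfalso; exact: (BW_not_short Wf Kx cf).
have Ky := AW_knot Wf; have cy := AW_carried Wf.
have [<-//|/neq_ltP[yx|xy]] := pselect (y = x); exfalso; apply: f0.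
  exact: (carried_eq0 (next_le ha Ky Kx yx) (carried_meet cy cf)).
exact: (carried_eq0 (next_le ha Kx Ky xy) (carried_meet cf cy)).
Qed.

Lemma long_Psi x : longb a Psi x = BW x.
Proof.
apply/seteqP; split=> f; last first.
  move=> Bf; have [Kx Kp Ks] := BW_knot Bf; split => //.
  - by exists x; right.
  - exact: BW_carried.
  - move=> [_ cp]; apply: (BW_not_short Bf Kp).
    by rewrite (next_prev ha).
  - exact: (BW_not_short Bf).
move=> Lf; have [Kp Ks ncp] := longb_knots ha Lf.
have [Kx [y [Wf|Wf]] cf _ ncs] := Lf.
  exfalso; apply: (short_long ha Psi_neq0 (x := y) _ Lf).
  by rewrite short_Psi.
have [<-//|xy] := pselect (y = x).
have [Ky Kpy Ksy] := BW_knot Wf; have cy := BW_carried Wf.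
exfalso; have [yx|{}xy] := neq_ltP xy.
  apply: ncp; apply: carriedS (carried_meet cy cf) => //.
  exact: (next_le ha).
apply: ncs; apply: carriedS (carried_meet cf cy) => //.
exact: (prev_ge ha).
Qed.

(** A function of [Psi] not vanishing on the interval involves one of the finitely many [phi] in
    [Phi1] that do not vanish there. Each [phi] belongs to one knot [x0] and can occur only in
    functions attached to [x0] or [s x0]. *)
Lemma Psi_locally_finite : locally_finite Psi.
Proof.
move=> t u tuJ.
pose E := [set phi : L2 J | Phi1 phi /\ ~ vanishes_on `[t, u] phi].
have finE : finite_set E by case: hPhi1 => [[lf _ _] _]; exact: lf.
pose near_ phi x := A1 x phi \/ B1 x phi \/ A1 (p x) phi /\ K x.
have fin_near phi : Phi1 phi -> finite_set [set x | near_ phi x].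
  move=> Pphi; have phi0 : ip phi phi <> 0.
    by move=> /(ip_eq0 ipP) phiE; apply: (basis_neq0 hPhi1); rewrite -phiE.
  have AA x y : A1 x phi -> A1 y phi -> x = y.
    by move=> Ax Ay; apply: contrapT => xy; apply: phi0; exact: (short_orth ha xy Ax Ay).
  have BB x y : B1 x phi -> B1 y phi -> x = y.
    move=> Bx By; apply: contrapT => xy; apply: phi0.
    exact: (long_orth ha (basis_orth hPhi1) xy Bx By).
  have AB x y : A1 x phi -> B1 y phi -> False by exact: (short_long ha (basis_neq0 hPhi1)).
  have [x0 Px0] := basis_cover ha hPhi1 Pphi.
  apply: (@sub_finite_set _ _ [set x0; s x0]); last exact: finite_set2.
  move=> x [Ax|[Bx|[Ap Kx]]]; case: Px0 => P0.
  - by left; exact: AA.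
  - by case: (AB _ _ Ax P0).
  - by case: (AB _ _ P0 Bx).
  - by left; exact: BB.
  - by right; rewrite -(AA _ _ Ap P0) (next_prev ha)//; case: Ap.
  - by case: (AB _ _ Ap P0).
apply: (@sub_finite_set _ _ (\bigcup_(phi in E) \bigcup_(x in near_ phi) (AW x `|` BW x))).
  have nv (S : set (L2 J)) f : linspan S f -> ~ vanishes_on `[t, u] f ->
      exists2 phi, S phi & ~ vanishes_on `[t, u] phi.
    move=> Sf nf; apply: contrapT => nS; apply: nf.
    move: Sf; apply: linspan_sub; first exact: vanishes_submodule.
    by move=> phi Sphi; apply: contrapT => nv; apply: nS; exists phi.
  move=> f [[x [Wf|Wf]] nf].
    have [phi Aphi nphi] := nv _ _ (tsAW_sub tsc Wf) nf.
    exists phi; first by split => //; case: Aphi.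
    by exists x; left.
  have [Kx _ _] := BW_knot Wf.
  have [phi Tphi nphi] := nv _ _ (tsBW_sub tsc Wf) nf.
  exists phi; first by split => //; case: Tphi => [[[]|[]]|[]].
  exists x; last by right.
  by case: Tphi => [[Ap|Bp]|Ap]; [right; right|right; left|left].
apply: bigcup_finite => // phi [Pphi _]; apply: bigcup_finite; first exact: fin_near.
by move=> x _; rewrite finite_setU; split; [exact: (tsAW_finite tsc)|exact: (tsBW_finite tsc)].
Qed.

Lemma Psi_basis : orthogonal_centered_basis a Psi.
Proof.
split; last exact: Psi_orth.
have atE r : a r -> at_knot a Psi r = AW r%:E `|` BW r%:E.
  by move=> ar; rewrite (at_knotE ha Psi_neq0)// short_Psi long_Psi.
split; first exact: Psi_locally_finite.
- apply/seteqP; split=> f; last by move=> [r ar [[]]].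
  move=> [x Wf]; have Kx : K x by case: Wf => [/AW_knot//|/BW_knot[]].
  by case: x Kx Wf => // r ar Wf; exists r => //; rewrite atE.
- move=> r ar; rewrite atE// (barE ha Psi_neq0); last exact: (next_knot ha (x := r%:E)).
  rewrite long_Psi; apply: span_restr_lin_indep.
    have SPsi : AW r%:E `|` BW r%:E `|` BW (s r%:E) `<=` Psi.
      by move=> f [[]|] Wf; [exists r%:E; left|exists r%:E; right|exists (s r%:E); right].
    by split=> [/SPsi/Psi_neq0|f g /SPsi Pf /SPsi Pg]; last exact: Psi_orth.
  by move=> w Sw Nw; exact: (ts_indep tsc (x := r%:E)).
Qed.

End psi.

End complement.

Theorem theorem7 (R : realType) (J : interval R) (a : set R)
    (Phi0 Phi1 : set (L2 J))
    (ha : knot_sequence J a)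
    (hPhi0 : orthogonal_centered_basis a Phi0)
    (hPhi1 : orthogonal_centered_basis a Phi1)
    (hV : clspan Phi0 `<=` clspan Phi1) :
  exists Psi : set (L2 J),
    [/\ orthogonal_centered_basis a Psi,
        is_orthogonal_sum (clspan Phi1) (clspan Phi0) (clspan Psi) &
        clspan Psi = orthocomplement_in (clspan Phi1) (clspan Phi0)].
Proof.
have ipP := @L2_inner_product R J.
have [AW [BW tsc]] := complement_exists ha hPhi0 hPhi1 hV.
pose Psi := Psi_of AW BW; exists Psi.
have oV : orthogonal_sets (clspan Phi0) (clspan Psi).
  move=> f g; rewrite !clspanE; apply: (orth_clos ipP).
  exact/(orth_span ipP)/(orthC ipP)/(Psi_orth0 ha hPhi0 tsc).
have subW : clspan Psi `<=` clspan Phi1.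
  rewrite !clspanE; apply: (clos_closS ipP) => f Pf.
  exact/(sub_clos ipP)/(Psi_span1 tsc).
(* [Phi0] and [Psi] together generate [V1], and an element orthogonal to [Phi0] is approximated by
   [Psi] alone. *)
have inW f : clspan Phi1 f -> (forall g, Phi0 g -> L2_inner f g = 0) -> clspan Psi f.
  move=> V1f f0; rewrite clspanE; apply: (clos_orthU ipP (S := Phi0)) => //.
    exact: (Psi_orth0 ha hPhi0 tsc).
  move: V1f; rewrite clspanE; apply: (clos_closS ipP) => g Pg.
  exact/(sub_clos ipP)/(Psi_gen ha hPhi1 tsc).
split.
- exact: (Psi_basis ha hPhi0 hPhi1 tsc).
- split => //; apply/seteqP; split=> f.
    move=> V1f; have [[lf0 _ _] o0] := hPhi0.
    (* The difference [f - v] stays in [V1] and is orthogonal to [Phi0], so [inW] applies to it. *)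
    have [v V0v fv] := clspan_proj lf0 o0 f.
    exists v, (f - v); split => //.
      apply: inW => //; move: V1f (hV _ V0v); rewrite clspanE.
      exact: (submoduleB (clos_submodule ipP (linspan_submodule _))).
    by apply: (aeS (L2_BE f v)) => x fvx _ /=; rewrite fvx subrKC.
  move=> [v [w [V0v Ww fE]]].
  have -> : f = v + w.
    by apply: L2_eqP; apply: (aeS (aeI fE (L2_DE v w))) => x [h ->]; exact: h.
  move: (hV _ V0v) (subW _ Ww); rewrite clspanE.
  exact: (submoduleD (clos_submodule ipP (linspan_submodule _))).
- apply/seteqP; split=> f.
    by move=> Wf; split; [exact: subW|move=> g V0g; rewrite (ipC ipP); exact: oV].
  by move=> [V1f f0]; apply: inW => // g Pg; apply/f0/sub_clspan.
Qed.
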